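(* Let $\Omega$ be a compact metric space, $T:\Omega\to\Omega$ a homeomorphism, $a\in C(\Omega,\mathbb C)$ and $b\in C(\Omega,\mathbb R)$, with associated Jacobi operators $J_\omega$ ($\omega\in\Omega$) and Jacobi cocycle maps $B^E:\Omega\to\mathrm M(2,\mathbb C)$ ($E\in\mathbb C$). Assume that $T$ is topologically transitive and let $\omega_0\in\Omega$ be such that $\overline{\{T^n\omega_0:n\in\mathbb Z\}}=\Omega$. Then $$\rho(J_{\omega_0})=\{E\in\mathbb C:\ (T,B^E)\text{ has dominated splitting}\},$$ where $\rho(J_{\omega_0})=\mathbb C\setminus\sigma(J_{\omega_0})$ is the resolvent set.
   Context: Topologically transitive means: there is a point of $\Omega$ whose two-sided $T$-orbit is dense in $\Omega$. For $\omega\in\Omega$, $J_\omega:\ell^2(\mathbb Z)\to\ell^2(\mathbb Z)$ is $(J_\omega\psi)(n)=\overline{a(T^{n-1}\omega)}\psi(n-1)+a(T^n\omega)\psi(n+1)+b(T^n\omega)\psi(n)$. The Jacobi cocycle map is $B^E(\omega)=\begin{pmatrix}E-b(\omega)&-\overline{a(T^{-1}\omega)}\\ a(\omega)&0\end{pmatrix}$. Points of $\mathbb C\mathbb P^1=\mathbb C\cup\{\infty\}$ are identified with one-dimensional subspaces of $\mathbb C^2$: $z\in\mathbb C$ with $\mathrm{span}\{\binom1z\}$ and $\infty$ with $\mathrm{span}\{\binom01\}$. For $B\in C(\Omega,\mathrm M(2,\mathbb C))$ and $n\ge1$ put $B_n(\omega)=B(T^{n-1}\omega)\cdots B(\omega)$.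 Definition. $(T,B)$ has dominated splitting if there are two maps $E^s,E^u:\Omega\to\mathbb C\mathbb P^1$ such that: (1) $E^s,E^u$ are continuous; (2) $B(\omega)[E^s(\omega)]\subseteq E^s(T\omega)$ and $B(\omega)[E^u(\omega)]\subseteq E^u(T\omega)$ for all $\omega\in\Omega$; (3) there are a positive integer $N$ and $\lambda>1$ such that $\|B_N(\omega)\vec u\|>\lambda\|B_N(\omega)\vec s\|$ for all $\omega\in\Omega$ and all unit vectors $\vec u\in E^u(\omega)$, $\vec s\in E^s(\omega)$. *)

(* Defs.v *)
From HB Require Import structures.
From mathcomp Require Import all_boot all_order all_algebra complex.
From mathcomp Require Import all_classical all_reals all_analysis.
From mathcomp Require Import ring lra.

Set Implicit Arguments.
Unset Strict Implicit.
Unset Printing Implicit Defensive.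

Import Order.TTheory GRing.Theory Num.Theory.
Import numFieldNormedType.Exports.
Import ComplexField.

Local Open Scope classical_set_scope.
Local Open Scope ring_scope.
Local Open Scope complex_scope.

(* The library puts the modulus topology on the alias R[i]^o; we transfer it to
   R[i] itself. The norm `|z| of z : R[i] lives in R[i]; its real counterpart is
   Normc.normc z. *)
HB.instance Definition _ (R : rcfType) := NormedModule.copy R[i] R[i]^o.

Lemma normcE (R : realType) (z : R[i]) : `|z| = (Normc.normc z)%:C.
Proof. by []. Qed.

Lemma normc_ge0 (R : realType) (z : R[i]) : 0 <= Normc.normc z.
Proof. by case: z => x y; exact: sqrtr_ge0. Qed.

Section ell2.
Variable R : realType.
Implicit Types (f g : int -> R[i]).

Local Notation normc := (@Normc.normc R).

(* Sum of |f n|^2 over the integers, possibly +oo. *)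
Definition sqsum f : \bar R := \esum_(n in [set: int]) (normc (f n) ^+ 2)%:E.

Lemma sqsum_ge0 f : (0 <= sqsum f)%E.
Proof. by apply: esum_ge0 => n _; rewrite lee_fin sqr_ge0. Qed.

Lemma le_esumZl (c : R) (u : int -> R) : 0 <= c -> (forall n, 0 <= u n) ->
  (\esum_(n in [set: int]) (c * u n)%:E <=
     c%:E * \esum_(n in [set: int]) (u n)%:E)%E.
Proof.
move=> c0 u0; apply: ge_ereal_sup => _ [A [finA _] <-].
rewrite fsbig_finite//= sumEFin -mulr_sumr EFinM lee_wpmul2l ?lee_fin//.
apply: ereal_sup_ubound; exists A => //.
by rewrite fsbig_finite//= sumEFin.
Qed.

Lemma sqsumD (t : R) f g : 0 < t ->
  (sqsum (fun n => f n + g n)%R <= (1 + t)%:E * sqsum f + (1 + t^-1)%:E * sqsum g)%E.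
Proof.
move=> t0; have ti0 : 0 < t^-1 by rewrite invr_gt0.
apply: (@le_trans _ _ (\esum_(n in [set: int]) ((1 + t) * normc (f n) ^+ 2)%:E
    + \esum_(n in [set: int]) ((1 + t^-1) * normc (g n) ^+ 2)%:E)%E); last first.
  by apply: leeD; apply: le_esumZl => *; rewrite ?sqr_ge0// addr_ge0// ltW.
rewrite -esumD; last 2 first.
- by move=> n _; rewrite lee_fin mulr_ge0 ?sqr_ge0// addr_ge0// ltW.
- by move=> n _; rewrite lee_fin mulr_ge0 ?sqr_ge0// addr_ge0// ltW.
apply: le_esum => n _; rewrite -EFinD lee_fin /=.
have := le_normcD (f n) (g n).
have := normc_ge0 (f n + g n); have := normc_ge0 (f n); have := normc_ge0 (g n).
set x := normc (f n); set y := normc (g n); set z := normc _ => y0 x0 z0 zxy.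
apply: (@le_trans _ _ ((x + y) ^+ 2)); first by rewrite ler_sqr ?nnegrE ?addr_ge0.
rewrite -subr_ge0.
rewrite (_ : _ - _ = t * (x - t^-1 * y) ^+ 2).
  by rewrite mulr_ge0 ?sqr_ge0// ltW.
by field; rewrite gt_eqF.
Qed.

Lemma le_sqsumZ (c : R[i]) f :
  (sqsum (fun n => (c * f n)%R) <= (normc c ^+ 2)%:E * sqsum f)%E.
Proof.
rewrite /sqsum; under eq_esum do rewrite Normc.normcM exprMn.
by apply: le_esumZl => *; rewrite sqr_ge0.
Qed.

Definition ell2_pred : {pred (int -> R[i])} := mem [set f | (sqsum f < +oo)%E].

Lemma ell2_submod_closed : submod_closed ell2_pred.
Proof.
have sqsumy c f : (sqsum f < +oo)%E -> (c%:E * sqsum f < +oo)%E.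
  move=> ffin; have ffn : sqsum f \is a fin_num.
    by rewrite ge0_fin_numE// sqsum_ge0.
  by rewrite -(fineK ffn) -EFinM ltry.
split; first by rewrite inE/= /sqsum esum1// => n _; rewrite Normc.normc0 expr0n.
move=> c f g; rewrite !inE /= => ffin gfin.
apply: (le_lt_trans (sqsumD (c *: f) g ltr01)).
apply: lte_add_pinfty; last exact: sqsumy.
apply: (@le_lt_trans _ _ ((1 + 1)%:E * ((normc c ^+ 2)%:E * sqsum f)))%E.
  by rewrite lee_wpmul2l ?lee_fin// le_sqsumZ.
by rewrite muleA -EFinM; exact: sqsumy.
Qed.

HB.instance Definition _ :=
  GRing.isSubmodClosed.Build _ _ ell2_pred ell2_submod_closed.

Record ell2 := Ell2 { ell2_fun :> int -> R[i]; ell2P : ell2_fun \in ell2_pred }.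

HB.instance Definition _ := [isSub for ell2_fun].
HB.instance Definition _ := [Choice of ell2 by <:].
HB.instance Definition _ := [SubChoice_isSubLmodule of ell2 by <:].

Definition ell2_norm (f : ell2) : R := Num.sqrt (fine (sqsum f)).

Lemma sqsumE (f : ell2) : sqsum f = (ell2_norm f ^+ 2)%:E.
Proof.
have := ell2P f; rewrite inE /= => ffin.
rewrite sqr_sqrtr ?fine_ge0 ?sqsum_ge0// fineK//.
by rewrite ge0_fin_numE// sqsum_ge0.
Qed.

Lemma ell2_norm_ge0 (f : ell2) : 0 <= ell2_norm f.
Proof. exact: sqrtr_ge0. Qed.

Lemma ell2_norm_eq0 (f : ell2) : ell2_norm f = 0 -> f = 0.
Proof.
move=> f0; apply/val_inj/funext => n /=; apply: Normc.eq0_normc.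
have : ((normc (f n) ^+ 2)%:E <= sqsum f)%E.
  apply: esum_ge; exists [set n]; first by split; [exact: finite_set1|].
  by rewrite fsbig_set1.
rewrite sqsumE f0 expr0n/= lee_fin => h.
by apply/eqP; rewrite -sqrf_eq0 eq_le h sqr_ge0.
Qed.

Lemma ell2_normD (f g : ell2) : ell2_norm (f + g) <= ell2_norm f + ell2_norm g.
Proof.
have [f0|fn0] := eqVneq (ell2_norm f) 0.
  by rewrite f0 (ell2_norm_eq0 f0) !add0r.
have [g0|gn0] := eqVneq (ell2_norm g) 0.
  by rewrite g0 (ell2_norm_eq0 g0) !addr0.
have f0 : 0 < ell2_norm f by rewrite lt_neqAle eq_sym fn0 ell2_norm_ge0.
have g0 : 0 < ell2_norm g by rewrite lt_neqAle eq_sym gn0 ell2_norm_ge0.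
have := @sqsumD (ell2_norm g / ell2_norm f) f g (divr_gt0 g0 f0).
have -> : (fun n => f n + g n) = ell2_fun (f + g) by [].
rewrite !sqsumE -!EFinM -EFinD lee_fin => h.
rewrite -ler_sqr ?nnegrE ?addr_ge0 ?ell2_norm_ge0// (le_trans h)// le_eqVlt.
by apply/orP; left; apply/eqP; field; rewrite fn0 gn0.
Qed.

Lemma ell2_normZ (c : R[i]) (f : ell2) :
  ell2_norm (c *: f) = normc c * ell2_norm f.
Proof.
have le (d : R[i]) (g : ell2) : ell2_norm (d *: g) <= normc d * ell2_norm g.
  have := le_sqsumZ d g; have -> : (fun n => d * g n) = ell2_fun (d *: g) by [].
  rewrite !sqsumE -EFinM lee_fin -exprMn.
  by rewrite ler_sqr ?nnegrE ?mulr_ge0 ?ell2_norm_ge0 ?normc_ge0.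
apply/eqP; rewrite eq_le le /=.
have [->|c0] := eqVneq c 0.
  by rewrite Normc.normc0 mul0r ell2_norm_ge0.
have n0 : 0 < normc c.
  rewrite lt_neqAle normc_ge0 andbT eq_sym; apply: contra c0 => /eqP h.
  by rewrite (Normc.eq0_normc h).
rewrite -{1}[f](scalerK c0) mulrC -ler_pdivlMr//.
by rewrite (le_trans (le _ _))// Normc.normcV mulrC.
Qed.

(* A normedModType over R[i] has its norm valued in R[i], hence the cast. *)
Definition ell2_normC (f : ell2) : R[i] := (ell2_norm f)%:C.

Fact ell2_normC_triangle (f g : ell2) :
  ell2_normC (f + g) <= ell2_normC f + ell2_normC g.
Proof. by rewrite /ell2_normC -rmorphD lecR ell2_normD. Qed.

Fact ell2_normC_scale (c : R[i]) (f : ell2) :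
  ell2_normC (c *: f) = `|c| * ell2_normC f.
Proof. by rewrite /ell2_normC ell2_normZ rmorphM. Qed.

Fact ell2_normC_eq0 (f : ell2) : ell2_normC f = 0 -> f = 0.
Proof. by case=> /ell2_norm_eq0. Qed.

HB.instance Definition _ := @Lmodule_isNormed.Build R[i] ell2
  ell2_normC ell2_normC_triangle ell2_normC_scale ell2_normC_eq0.

End ell2.


(* A has a two-sided inverse that is a bounded linear operator. *)
Definition bounded_inverse (K : numFieldType) (V : normedModType K)
    (A : V -> V) :=
  exists S : {linear V -> V}, [/\ continuous S, cancel A S & cancel S A].

Definition spectrum (K : numFieldType) (V : normedModType K) (A : V -> V) :
    set K :=
  [set E | ~ bounded_inverse (fun x => A x - E *: x)].

Definition resolvent_set (K : numFieldType) (V : normedModType K)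
    (A : V -> V) : set K :=
  ~` spectrum A.

Record homeo (X : topologicalType) := Homeo {
  homeo_fun :> X -> X;
  homeo_inv : X -> X;
  homeo_funK : cancel homeo_fun homeo_inv;
  homeo_invK : cancel homeo_inv homeo_fun;
  homeo_continuous : continuous homeo_fun;
  homeo_inv_continuous : continuous homeo_inv }.

(* T^n for n : int; Negz k is the integer -(k+1). *)
Definition iterz (X : topologicalType) (T : homeo X) (n : int) : X -> X :=
  match n with
  | Posz k => iter k T
  | Negz k => iter k.+1 (homeo_inv T)
  end.

Definition two_sided_orbit (X : topologicalType) (T : homeo X) (x : X) : set X :=
  range (fun n : int => iterz T n x).

Definition topologically_transitive (X : topologicalType) (T : homeo X) :=
  exists x : X, dense (two_sided_orbit T x).

Section jacobi.
Variables (R : realType) (X : metricType R) (T : homeo X).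
Variables (a : continuousType X R[i]) (b : continuousType X R).
Hypothesis cptX : compact [set: X].

Local Notation normc := (@Normc.normc R).

Definition jacobi_seq (w : X) (psi : int -> R[i]) : int -> R[i] := fun n =>
  (a (iterz T (n - 1) w))^* * psi (n - 1) + a (iterz T n w) * psi (n + 1)
  + (b (iterz T n w))%:C * psi n.

Let normc_continuous : continuous (normc : R[i] -> R).
Proof.
move=> z A /nbhs_ballP[e /= e0 eA].
have e0C : 0 < e%:C :> R[i] by rewrite ltcR.
apply/nbhs_ballP; exists e%:C => // y.
rewrite /ball/= normcE ltcR => zy; apply: eA; apply: le_lt_trans zy.
rewrite ler_norml; apply/andP; split.
  rewrite lerBrDl addrC -lerBrDl opprK -{1}(subrK z y) addrC.
  by rewrite (le_trans (le_normcD _ _))// lerD2l -(normcN (y - z)) opprB.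
by rewrite lerBlDr -{1}(subrK y z) le_normcD.
Qed.

Let bounded_normc (u : X -> R[i]) : continuous u ->
  exists M : R, forall x, normc (u x) <= M.
Proof.
move=> cu; have cnu : continuous (normc \o u : X -> R).
  by move=> x; apply: continuous_comp; [exact: cu|exact: normc_continuous].
have /compact_bounded : compact ((normc \o u : X -> R) @` [set: X]).
  by apply: continuous_compact => //; exact: continuous_subspaceT.
move=> [M [_ bM]]; exists (M + 1) => x.
have := bM (M + 1) _ (normc (u x)); rewrite /= ger0_norm ?normc_ge0//.
by apply; [rewrite ltrDl|exists x].
Qed.

Let ell2_bounded_mul (u : int -> R[i]) (M : R) (e : int -> int) (f : ell2 R) :
  (forall n, normc (u n) <= M) -> bijective e ->
  (fun n => u n * f (e n)) \in @ell2_pred R.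
Proof.
move=> uM be; rewrite inE /=.
have M0 : 0 <= M by exact: le_trans (normc_ge0 _) (uM 0).
apply: (@le_lt_trans _ _ ((M ^+ 2)%:E * sqsum f)%E); last first.
  by rewrite sqsumE -EFinM ltry.
apply: (@le_trans _ _
    (\esum_(n in [set: int]) (M ^+ 2 * normc (f (e n)) ^+ 2)%:E)).
  apply: le_esum => n _; rewrite lee_fin Normc.normcM exprMn.
  by rewrite ler_wpM2r ?sqr_ge0// ler_sqr ?nnegrE ?normc_ge0.
apply: le_trans (le_esumZl _ _) _ => [|n|]; rewrite ?sqr_ge0//.
rewrite [sqsum f](@reindex_esum _ _ _ [set: int] [set: int] e)//.
by rewrite setTT_bijective.
Qed.

Fact jacobi_seq_ell2 (w : X) (psi : ell2 R) :
  jacobi_seq w psi \in @ell2_pred R.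
Proof.
have [Ma aM] := bounded_normc (@cts_fun _ _ a).
have [Mb bM] : exists M : R, forall x, normc (b x)%:C <= M.
  have /compact_bounded : compact (b @` [set: X]).
    apply: continuous_compact => //; apply: continuous_subspaceT.
    exact: (@cts_fun _ _ b).
  move=> [M [_ bM]]; exists (M + 1) => x.
  rewrite /= expr0n/= addr0 sqrtr_sqr.
  by apply: (bM (M + 1)); [rewrite ltrDl|exists x].
apply: rpredD; [apply: rpredD|].
- apply: (@ell2_bounded_mul _ Ma (fun n => n - 1)).
    move=> n; rewrite (le_trans _ (aM (iterz T (n - 1) w)))//.
    by case: (a _) => x y /=; rewrite sqrrN.
  by exists (fun n => n + 1) => n; rewrite ?subrK ?addrK.
- apply: (@ell2_bounded_mul _ Ma (fun n => n + 1)) => //.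
  by exists (fun n => n - 1) => n; rewrite ?subrK ?addrK.
- by apply: (@ell2_bounded_mul _ Mb id) => //; exists id.
Qed.

(* Compactness of X makes a and b bounded, which is what keeps jacobi_seq
   inside ell2. *)
Definition jacobi (w : X) (psi : ell2 R) : ell2 R :=
  Ell2 (jacobi_seq_ell2 w psi).

Definition jacobi_cocycle (E : R[i]) (w : X) : 'M[R[i]]_2 :=
  \matrix_(i < 2, j < 2)
    if i == 0 then (if j == 0 then E - (b w)%:C
                    else - (a (homeo_inv T w))^*)
    else (if j == 0 then a w else 0).

End jacobi.

Section dominated_splitting.
Variables (R : realType) (X : topologicalType).

(* The Riemann sphere: Some z is the line spanned by (1, z) and the added point
   None = infinity is the line spanned by (0, 1). *)
Definition CP1 := one_point_compactification R[i].

Definition line (z : CP1) : set 'cV[R[i]]_2 :=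
  let v : 'cV[R[i]]_2 := match z with
    | Some z => \col_(i < 2) (if i == 0 then 1 else z)
    | None => \col_(i < 2) (if i == 0 then 0 else 1)
    end in
  [set c *: v | c in [set: R[i]]].

(* The library norm on matrices is the sup norm, so the Euclidean norm of C^2
   is spelled out. *)
Definition eucl_norm (v : 'cV[R[i]]_2) : R :=
  Num.sqrt (\sum_(i < 2) Normc.normc (v i 0) ^+ 2).

(* B(T^(n-1) w) ... B(T w) B(w). *)
Fixpoint cocycle_iter (T : X -> X) (B : X -> 'M[R[i]]_2) (n : nat) (w : X) :
    'M[R[i]]_2 :=
  match n with
  | 0 => 1%:M
  | m.+1 => B (iter m T w) *m cocycle_iter T B m w
  end.

Definition dominated_splitting (T : X -> X) (B : X -> 'M[R[i]]_2) :=
  exists Es Eu : X -> CP1,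
  [/\ continuous Es /\ continuous Eu,
      forall w, (mulmx (B w) @` line (Es w) `<=` line (Es (T w))) /\
                (mulmx (B w) @` line (Eu w) `<=` line (Eu (T w))) &
      exists (N : nat) (lambda : R), [/\ (0 < N)%N, 1 < lambda &
        forall w (u s : 'cV[R[i]]_2),
          line (Eu w) u -> eucl_norm u = 1 ->
          line (Es w) s -> eucl_norm s = 1 ->
          eucl_norm (cocycle_iter T B N w *m u)
            > lambda * eucl_norm (cocycle_iter T B N w *m s)]].

End dominated_splitting.

(* Main.v *)
(* Invertibility of J - E at w0 gives |f|^2 <= C |(J - E) f|^2 for w0, hence, by
   truncation and density of the orbit, for J_w with every w. The stable
   (unstable) line at w consists of the vectors (psi 0, psi (-1)) for the
   solutions of (J_w - E) psi = 0 that are square summable at +oo (-oo); the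
   inequality bounds these solutions by their initial vectors, which yields
   transversality, domination and, by compactness, continuity. The lines are
   nonzero on the orbit, since otherwise two columns of the Green function would
   be solutions with nonzero Wronskian, square summable at the same end;
   compactness extends this to every w.

   Conversely, let B s = c s' and B u = d u' with s and u spanning the two
   invariant lines; d is bounded away from 0. In the coordinates along u and s,
   (J - E) g = f becomes a pair of recursions, running backward with coefficients
   q = a / d and forward with coefficients p, where p q = c / d. Over long
   intervals the products of |p| and of |q| are comparable up to a shift of the
   interval by one, so domination makes both small. This gives the inequality as
   well as the columns of the Green function; general right-hand sides are
   reached by pointwise limits. *)

From HB Require Import structures.
Require Import Defs.
From mathcomp Require Import all_boot all_order all_algebra complex.
From mathcomp Require Import all_classical all_reals all_analysis.
From mathcomp Require Import ring lra zify.

Set Implicit Arguments.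
Unset Strict Implicit.
Unset Printing Implicit Defensive.

Import Order.TTheory GRing.Theory Num.Theory.
Import numFieldNormedType.Exports.

Local Open Scope classical_set_scope.
Local Open Scope ring_scope.

(** The obstacle is that [a] may vanish. The cocycle is then not invertible, and it sends the pair
    [(psi n, psi (n - 1))] of a solution only to [a] times the next pair. This is why the lines are
    defined through half-line solutions, and why the factors [a] met along an orbit segment are kept
    as one product, which links the estimate for the stable vector to that for the unstable one even
    when it is zero. In the converse direction the denominators are the unstable multiplier and the
    determinant of the two sections, never [a].

    The inequality is the central notion because, unlike invertibility, it passes to limits of the
    base point with a uniform constant. No exponential decay is proved: tail bounds at all sites up
    to N, added up, give decay like 1 / (N + 1) of squared norms, and a single large N suffices for
    domination.

    Balls of l^2 are used as compact sets for pointwise convergence; bounds on finite sums and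
    equations at single sites are closed conditions there. Most facts at -oo come from those at +oo
    by the reflection n -> -1 - n. *)

Local Notation nm := Normc.normc.

(** * The modulus on the complex numbers: inequalities and continuity *)

Section modulus.
Variable R : realType.
Implicit Types x y z : R[i].

Lemma nmD x y : nm (x + y) <= nm x + nm y.
Proof. exact: le_normcD. Qed.

Lemma nmN x : nm (- x) = nm x.
Proof. exact: (@normcN R x). Qed.

Lemma nmB x y : nm (x - y) <= nm x + nm y.
Proof. by rewrite -(nmN y) nmD. Qed.

Lemma nm_conj x : nm (conjc x) = nm x.
Proof. by case: x => p q /=; rewrite sqrrN. Qed.

Lemma nm_eq0 x : (nm x == 0) = (x == 0).
Proof. by apply/eqP/eqP => [/Normc.eq0_normc //|->]; exact: Normc.normc0. Qed.

Lemma nm_gt0 x : (0 < nm x) = (x != 0).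
Proof. by rewrite lt_neqAle normc_ge0 andbT eq_sym nm_eq0. Qed.

Lemma nm_sqrD x y : nm (x + y) ^+ 2 <= 2 * nm x ^+ 2 + 2 * nm y ^+ 2.
Proof.
have := nmD x y; have := normc_ge0 (x + y).
set a := nm _; set b := nm x; set c := nm y => a0 abc.
have : a ^+ 2 <= (b + c) ^+ 2 by rewrite ler_sqr ?nnegrE//; lra.
have := sqr_ge0 (b - c); lra.
Qed.

Lemma nm_sqrD3 x y z :
  nm (x + y + z) ^+ 2 <= 3 * nm x ^+ 2 + 3 * nm y ^+ 2 + 3 * nm z ^+ 2.
Proof.
have := nmD (x + y) z; have := nmD x y; have := normc_ge0 (x + y + z).
set a := nm _; set b := nm x; set c := nm y; set d := nm z.
set e := nm (x + y) => a0 eb ae.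
have abcd : a <= b + c + d by lra.
have : a ^+ 2 <= (b + c + d) ^+ 2 by rewrite ler_sqr ?nnegrE//; lra.
have := sqr_ge0 (b - c); have := sqr_ge0 (b - d); have := sqr_ge0 (c - d); lra.
Qed.

Lemma nm_mulb (c M : R) x y : nm x <= M -> nm y <= c -> nm (x * y) <= M * c.
Proof.
move=> xM yc; rewrite Normc.normcM.
by apply: ler_pM => //; exact: normc_ge0.
Qed.

Lemma complex_gt0 (e : R[i]) : 0 < e -> exists2 e' : R, 0 < e' & e = (e'%:C)%C.
Proof.
case: e => x y; rewrite ltcE /= => /andP[/eqP -> x0].
by exists x.
Qed.

Lemma nm_continuous : continuous (@Normc.normc R : R[i] -> R).
Proof.
move=> z A /nbhs_ballP[e /= e0 eA].
have e0C : 0 < (e%:C)%C :> R[i] by rewrite ltcR.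
apply/nbhs_ballP; exists (e%:C)%C => // y.
rewrite /ball/= Defs.normcE ltcR => zy; apply: eA; apply: le_lt_trans zy.
have := nmD (z - y) y; have := nmD (y - z) z; rewrite !subrK -(nmN (y - z)) opprB.
by rewrite ler_norml; lra.
Qed.

Lemma nm_comp_continuous (X : topologicalType) (f : X -> R[i]) :
  continuous f -> continuous (@Normc.normc R \o f : X -> R).
Proof.
by move=> cf x; apply: continuous_comp; [exact: cf|exact: nm_continuous].
Qed.

Lemma conjc_continuous : continuous (@conjc R).
Proof.
move=> z A /nbhs_ballP[e /= e0 eA]; apply/nbhs_ballP; exists e => // y zy.
apply: eA; move: zy; rewrite /ball /= !Defs.normcE.
by rewrite -(nm_conj (z - y)) rmorphB.
Qed.

Lemma real_complex_continuous : continuous (fun x : R => (x%:C)%C : R[i]).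
Proof.
move=> x A /nbhs_ballP[_ /= /complex_gt0[e e0 ->] eA].
apply/nbhs_ballP; exists e => //= y xy; apply: eA.
by move: xy; rewrite /ball /= Defs.normcE ltcR -rmorphB /= expr0n /= addr0 sqrtr_sqr.
Qed.

End modulus.

(** * Summability over the integers through finite sums *)

Section sums_le.
Variable R : realType.
Implicit Types (u v : int -> R) (K L c : R) (s : seq int).

(* For u >= 0 this says that the sum of u over int is at most K. *)
Definition sums_le u K := forall s, uniq s -> \sum_(i <- s) u i <= K.

Lemma sums_le_ge0 u K : sums_le u K -> 0 <= K.
Proof. by move=> /(_ [::] isT); rewrite big_nil. Qed.

Lemma sums_leW u K L : K <= L -> sums_le u K -> sums_le u L.
Proof. by move=> KL uK s /uK /le_trans; exact. Qed.

Lemma le_sums_le u v K : (forall n, u n <= v n) -> sums_le v K -> sums_le u K.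
Proof. by move=> uv vK s us; apply: le_trans (vK _ us); exact: ler_sum. Qed.

Lemma sums_leD u v K L :
  sums_le u K -> sums_le v L -> sums_le (fun n => u n + v n) (K + L).
Proof. by move=> uK vL s us; rewrite big_split lerD ?uK ?vL. Qed.

Lemma sums_leZ u K c : 0 <= c -> sums_le u K -> sums_le (fun n => c * u n) (c * K).
Proof. by move=> c0 uK s us; rewrite -mulr_sumr ler_wpM2l// uK. Qed.

Lemma sums_le_term u K n : sums_le u K -> u n <= K.
Proof. by move=> /(_ [:: n] isT); rewrite big_seq1. Qed.

Lemma sums_le_inj u K (e : int -> int) : injective e ->
  sums_le u K -> sums_le (fun n => u (e n)) K.
Proof. by move=> ie uK s us; rewrite -(big_map e xpredT) uK// map_inj_uniq. Qed.

Lemma sums_le_least u K : sums_le u K ->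
  exists2 L, sums_le u L & forall L', sums_le u L' -> L <= L'.
Proof.
move=> uK; pose A := [set x | exists2 s, uniq s & x = \sum_(i <- s) u i].
have A0 : A !=set0 by exists (\sum_(i <- [::]) u i); exists [::].
exists (sup A).
  by move=> s us; apply: ub_le_sup; [exists K => _ [t ut ->]; exact: uK|exists s].
by move=> L' uL'; apply: ge_sup => // _ [t ut ->]; exact: uL'.
Qed.

(** The bound [K0] makes a least bound [L] of [u] available, and the recursion gives
    [L <= c * L + K]. Mere summability is thus turned into an estimate in which [K0] no longer
    occurs. *)
Lemma sums_le_contract u v (e : int -> int) c K K0 : injective e ->
  0 <= c -> c < 1 -> (forall n, u n <= c * u (e n) + v n) ->
  sums_le u K0 -> sums_le v K -> sums_le u (K / (1 - c)).
Proof.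
move=> ie c0 c1 uv uK0 vK; have [L uL Lmin] := sums_le_least uK0.
apply: sums_leW (uL); rewrite ler_pdivlMr ?subr_gt0//.
have : L <= c * L + K.
  by apply: Lmin; apply: le_sums_le (sums_leD (sums_leZ c0 (sums_le_inj ie uL)) vK).
lra.
Qed.

(** A finite list whose sum exceeds the least bound minus [e] leaves at most [e] for all other
    indices. *)
Lemma sums_le_tail u K e : (forall n, 0 <= u n) -> sums_le u K -> 0 < e ->
  exists2 s, uniq s & sums_le (fun n => if n \in s then 0 else u n) e.
Proof.
move=> u0 uK e0; have [L uL Lmin] := sums_le_least uK.
have /existsNP[s /not_implyP[us /negP]] : ~ sums_le u (L - e).
  by move=> /Lmin; lra.
rewrite -ltNge => sL; exists s => // t ut.
rewrite (eq_bigr (fun i => if i \notin s then u i else 0)); last first.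
  by move=> i _; case: (i \in s).
rewrite -big_mkcond -big_filter.
have := uL (s ++ [seq i <- t | i \notin s]).
rewrite big_cat /= cat_uniq us filter_uniq// andbT /=.
have -> : ~~ has (mem s) [seq i <- t | i \notin s].
  by apply/hasPn => x; rewrite mem_filter => /andP[].
move=> /(_ isT); lra.
Qed.

Lemma sums_le_support u s : uniq s -> (forall n, 0 <= u n) ->
  (forall n, n \notin s -> u n = 0) -> sums_le u (\sum_(i <- s) u i).
Proof.
move=> us u0 supp t ut.
have -> : \sum_(i <- t) u i = \sum_(i <- [seq i <- t | i \in s]) u i.
  rewrite big_filter [RHS]big_mkcond /=; apply: eq_bigr => i _.
  by case: ifPn => // /supp.
rewrite (perm_big [seq i <- s | i \in t]) /=; last first.
  apply: uniq_perm; rewrite ?filter_uniq// => i.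
  by rewrite !mem_filter andbC.
rewrite big_filter big_mkcond /=; apply: ler_sum => i _.
by case: ifP.
Qed.

Lemma sums_le_const u K c (e : nat -> int) : injective e ->
  (forall k, c <= u (e k)) -> sums_le u K -> c <= 0.
Proof.
move=> ie cu uK; rewrite leNgt; apply/negP => c0.
have K0 := sums_le_ge0 uK.
have /archi_boundP : 0 <= K / c by rewrite divr_ge0// ltW.
set n := Num.bound _; rewrite ltr_pdivrMr// => nK.
have := uK [seq e k | k <- iota 0 n]; rewrite map_inj_uniq// iota_uniq => /(_ isT).
rewrite big_map; suff : n%:R * c <= \sum_(j <- iota 0 n) u (e j) by lra.
apply: le_trans (ler_sum _ (fun i _ => cu i)).
by rewrite big_const_seq count_predT size_iota iter_addr addr0 mulr_natl.
Qed.

Lemma sqsum_leP (f : int -> R[i]) K :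
  (sqsum f <= K%:E)%E <-> sums_le (fun n => nm (f n) ^+ 2) K.
Proof.
split=> [fK s us|fK].
  rewrite -lee_fin; apply: le_trans fK; apply: ereal_sup_ubound.
  exists [set` s]; first by split => //; exact: finite_seq.
  by rewrite -fsbig_seq// sumEFin.
apply: ge_ereal_sup => _ [A [finA _] <-].
by rewrite fsbig_finite//= sumEFin lee_fin; apply: fK; exact: finmap.fset_uniq.
Qed.

End sums_le.

(** * Jacobi operators on sequences *)

Section jacobi_sequences.
Variable R : realType.
Implicit Types (al be f g psi : int -> R[i]) (C K M : R) (n k : int).

(** [K] bounds the square of the norm, so constants below are squares of operator norms. *)
Definition l2_le f K := sums_le (fun n => nm (f n) ^+ 2) K.

(** The spectral parameter is absorbed in [be], which is therefore complex-valued. *)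
Definition jac al be f n : R[i] :=
  conjc (al (n - 1)) * f (n - 1) + al n * f (n + 1) + be n * f n.

(** [K0] only says that [f] lies in l^2; as [K] varies, the rest says that the squared norm of [f]
    is at most [C] times that of [jac al be f]. *)
Definition coercive al be C := forall f K0 K,
  l2_le f K0 -> l2_le (jac al be f) K -> l2_le f (C * K).

Lemma jacD al be f g n :
  jac al be (fun n => f n + g n) n = jac al be f n + jac al be g n.
Proof. by rewrite /jac; ring. Qed.

Lemma jacZ al be (c : R[i]) f n :
  jac al be (fun n => c * f n) n = c * jac al be f n.
Proof. by rewrite /jac; ring. Qed.

Lemma l2_leD f g K L :
  l2_le f K -> l2_le g L -> l2_le (fun n => f n + g n) (2 * K + 2 * L).
Proof.
move=> fK gL; apply: le_sums_le (sums_leD (sums_leZ _ fK) (sums_leZ _ gL)) => //.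
by move=> n; exact: nm_sqrD.
Qed.

Lemma l2_leZ (c : R[i]) f K : l2_le f K -> l2_le (fun n => c * f n) (nm c ^+ 2 * K).
Proof.
move=> fK; apply: le_sums_le (sums_leZ _ fK) => //; last exact: sqr_ge0.
by move=> n; rewrite Normc.normcM exprMn.
Qed.

Lemma l2_le0 f n : l2_le f 0 -> f n = 0.
Proof.
move=> /(@sums_le_term _ _ _ n) h; apply/eqP; rewrite -nm_eq0 -sqrf_eq0.
by rewrite eq_le h sqr_ge0.
Qed.

Lemma l2_le_delta n : l2_le (fun k => (k == n)%:R : R[i]) 1.
Proof.
have := @sums_le_support _ (fun k => nm ((k == n)%:R : R[i]) ^+ 2) [:: n].
rewrite big_seq1 eqxx Normc.normc1 expr1n; apply=> // [k|k].
  exact: sqr_ge0.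
by rewrite inE => /negPf ->; rewrite Normc.normc0 expr0n.
Qed.

Lemma l2_le_inj f K (e : int -> int) : injective e -> l2_le f K ->
  l2_le (fun n => f (e n)) K.
Proof. by move=> ie; exact: sums_le_inj. Qed.

Lemma jac_l2 al be M f K : (forall n, nm (al n) <= M) -> (forall n, nm (be n) <= M) ->
  l2_le f K -> l2_le (jac al be f) (9 * M ^+ 2 * K).
Proof.
move=> alM beM fK.
have M2 : 0 <= 3 * M ^+ 2 by rewrite mulr_ge0// sqr_ge0.
have fpK : l2_le (fun n => f (n + 1)) K.
  by apply: l2_le_inj fK => x y; exact: addIr.
have fmK : l2_le (fun n => f (n - 1)) K.
  by apply: l2_le_inj fK => x y; exact: addIr.
have := sums_leD (sums_leD (sums_leZ M2 fmK) (sums_leZ M2 fpK)) (sums_leZ M2 fK).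
set L := (X in sums_le _ X); have -> : L = 9 * M ^+ 2 * K by rewrite /L; ring.
apply: le_sums_le => n; apply: le_trans (nm_sqrD3 _ _ _) _.
rewrite !Normc.normcM nm_conj !exprMn.
have sqM (x : R[i]) : nm x <= M -> nm x ^+ 2 <= M ^+ 2.
  by move=> xM; rewrite ler_sqr ?nnegrE ?normc_ge0// (le_trans (normc_ge0 x) xM).
have h (x y : R[i]) : nm x <= M -> nm x ^+ 2 * nm y ^+ 2 <= M ^+ 2 * nm y ^+ 2.
  by move=> xM; apply: ler_wpM2r; [exact: sqr_ge0|exact: sqM].
have := h _ (f (n - 1)) (alM (n - 1)); have := h _ (f (n + 1)) (alM n).
have := h _ (f n) (beM n); lra.
Qed.

Lemma coercive_eq0 al be C f K : coercive al be C -> l2_le f K ->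
  (forall n, jac al be f n = 0) -> forall n, f n = 0.
Proof.
move=> co fK jf n; apply: l2_le0; rewrite -(mulr0 C); apply: co fK _ => s us.
by rewrite big1// => i _; rewrite jf Normc.normc0 expr0n.
Qed.

(** Split [f] into a finitely supported [g] and a tail [h] of squared norm at most [e]. The sequence
    [jac g] lives on a fixed finite set, where the coefficients at some point of [D] are almost
    those at [x]; the inequality at that point is applied to [g]. The factor 4 stems from two uses
    of |x + y|^2 <= 2 |x|^2 + 2 |y|^2. *)
Lemma coercive_closure (X : topologicalType) (D : set X) (al be : X -> int -> R[i])
    C M : 0 <= C ->
  (forall n, continuous (al ^~ n)) -> (forall n, continuous (be ^~ n)) ->
  (forall x n, nm (al x n) <= M) -> (forall x n, nm (be x n) <= M) ->
  (forall x, D x -> coercive (al x) (be x) C) ->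
  forall x, closure D x -> coercive (al x) (be x) (4 * C).
Proof.
move=> C0 cal cbe alM beM co x Dx f K0 K fK0 fK.
have approx e : 0 < e -> l2_le f (C * (4 * K + 36 * M ^+ 2 * e + 2 * e) + e).
  move=> e0; have [s us tail] := sums_le_tail (fun n => sqr_ge0 _) fK0 e0.
  pose g n := if n \in s then f n else 0.
  pose h n := if n \in s then 0 else f n.
  have he : l2_le h e.
    apply: le_sums_le tail => n; rewrite /h; case: ifP => // _.
    by rewrite Normc.normc0 expr0n.
  have gK0 : l2_le g K0.
    apply: le_sums_le fK0 => n; rewrite /g; case: ifP => // _.
    by rewrite Normc.normc0 expr0n sqr_ge0.
  have gE : g = fun n => f n + (- 1) * h n.
    by apply/funext => n; rewrite /g /h; case: ifP => _; ring.
  have jxg : l2_le (jac (al x) (be x) g) (2 * K + 18 * M ^+ 2 * e).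
    have -> : jac (al x) (be x) g =
        fun n => jac (al x) (be x) f n + (- 1) * jac (al x) (be x) h n.
      by apply/funext => n; rewrite gE jacD jacZ.
    have := l2_leD fK (l2_leZ (- 1) (jac_l2 (alM x) (beM x) he)).
    by rewrite nmN Normc.normc1; congr l2_le; ring.
  (* Off [s] and its two translates [jac g] vanishes, whatever the coefficients. *)
  pose t := undup (s ++ [seq n + 1 | n <- s] ++ [seq n - 1 | n <- s]).
  have jg0 y n : n \notin t -> jac (al y) (be y) g n = 0.
    rewrite mem_undup !mem_cat !negb_or => /and3P[ns np nm'].
    rewrite /jac /g (negPf ns) ifN; last first.
      by apply: contra np => np; apply/mapP; exists (n - 1) => //; lia.
    rewrite ifN; last first.
      by apply: contra nm' => np'; apply/mapP; exists (n + 1) => //; lia.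
    by rewrite !mulr0 !addr0.
  (* The error [e] is shared among the sites of [t]; the successor keeps the denominator nonzero. *)
  pose e1 := e / (size t).+1%:R.
  have e10 : 0 < e1 by rewrite divr_gt0.
  pose F n y : R := nm (jac (al y) (be y) g n - jac (al x) (be x) g n) ^+ 2.
  have cF n : continuous (F n).
    have cG : continuous (@Normc.normc R \o
        (fun y => jac (al y) (be y) g n - jac (al x) (be x) g n) : X -> R).
      apply: nm_comp_continuous => y.
      apply: cvgB; last exact: cvg_cst.
      apply: cvgD; first apply: cvgD; apply: cvgM; try exact: cvg_cst;
        try exact: cal; try exact: cbe.
      by apply: continuous_comp; [exact: cal|exact: conjc_continuous].
    by move=> y; exact: (cvgM (cG y) (cG y)).
  have near_t : \forall y \near x, forall n, n \in t -> F n y <= e1.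
    elim: (t) => [|n r IH]; first by apply: nearW => y n; rewrite in_nil.
    have Fn : \forall y \near x, F n y < e1.
      move: (cF n x) => /cvgr_lt; apply.
      by rewrite /F subrr Normc.normc0 expr0n.
    near=> y => m; rewrite inE => /orP[/eqP ->|].
      by apply: ltW; near: y.
    by move: m; near: y.
  have [y [Dy Fy]] := Dx _ near_t.
  have diff : l2_le (fun n => jac (al y) (be y) g n - jac (al x) (be x) g n) e.
    apply: sums_leW; last first.
      apply: (@sums_le_support _ _ t); first exact: undup_uniq.
        by move=> n; exact: sqr_ge0.
      by move=> n nt; rewrite !jg0// subrr Normc.normc0 expr0n.
    apply: (@le_trans _ _ (\sum_(i <- t) e1)).
      by rewrite big_seq [leRHS]big_seq; apply: ler_sum => i; exact: Fy.
    rewrite big_const_seq count_predT iter_addr addr0 -mulr_natl /e1 mulrCA.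
    by rewrite ler_piMr ?(ltW e0)// ler_pdivrMr// mul1r ler_nat.
  have jyg : l2_le (jac (al y) (be y) g) (4 * K + 36 * M ^+ 2 * e + 2 * e).
    have := l2_leD jxg diff; set L := (X in l2_le _ X).
    have -> : L = 4 * K + 36 * M ^+ 2 * e + 2 * e by rewrite /L; ring.
    by apply: le_sums_le => n; rewrite addrC subrK.
  apply: le_sums_le (sums_leD (co _ Dy _ _ _ gK0 jyg) he) => n.
  rewrite /g /h; case: ifP => _; rewrite ?lerDl ?lerDr sqr_ge0//.
move=> s us; apply/ler_addgt0Pr => e e0.
(* With [e / q] in place of [e], the errors C (36 M^2 + 2) e / q and e / q add up to [e]. *)
pose q := C * (36 * M ^+ 2 + 2) + 1.
have q0 : 0 < q by rewrite ltr_wpDl// mulr_ge0// addr_ge0// mulr_ge0// sqr_ge0.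
apply: le_trans (approx (e / q) (divr_gt0 e0 q0) s us) _.
by rewrite le_eqVlt; apply/orP; left; apply/eqP; rewrite /q; field; rewrite -/q gt_eqF.
Unshelve. all: by end_near. Qed.

Section forward.
Variables (al be : int -> R[i]) (C M : R).
Hypotheses (C0 : 0 <= C) (co : coercive al be C).
Hypotheses (alM : forall n, nm (al n) <= M) (beM : forall n, nm (be n) <= M).

Let M0 : 0 <= M. Proof. exact: le_trans (normc_ge0 _) (alM 0). Qed.

(** Cut [psi] off to the left of [k - 1]. The truncation solves the equation except at [k - 2] and
    [k - 1], where the defect involves only [psi (k - 1)] and [psi k]; coercivity then bounds the
    whole tail. The 3 collects one term from [k - 2] and a doubled one from [k - 1]. *)
Lemma forward_bound psi k K : l2_le psi K ->
  (forall n, k <= n -> jac al be psi n = 0) ->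
  sums_le (fun n => if k - 1 <= n then nm (psi n) ^+ 2 else 0)
    (3 * C * M ^+ 2 * (nm (psi k) ^+ 2 + nm (psi (k - 1)) ^+ 2)).
Proof.
move=> psiK jpsi.
pose g n := if k - 1 <= n then psi n else 0.
have gE n : (if k - 1 <= n then nm (psi n) ^+ 2 else 0) = nm (g n) ^+ 2.
  by rewrite /g; case: ifP => // _; rewrite Normc.normc0 expr0n.
apply: le_sums_le (_ : l2_le g _); first by move=> n; rewrite gE.
have gK : l2_le g K.
  apply: le_sums_le psiK => n; rewrite -gE; case: ifP => // _; exact: sqr_ge0.
have -> : 3 * C * M ^+ 2 * (nm (psi k) ^+ 2 + nm (psi (k - 1)) ^+ 2) =
  C * (3 * M ^+ 2 * (nm (psi k) ^+ 2 + nm (psi (k - 1)) ^+ 2)) by ring.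
apply: co gK _.
have us : uniq [:: k - 2; k - 1] by rewrite /= inE andbT; lia.
have := @sums_le_support _ (fun n => nm (jac al be g n) ^+ 2) _ us.
move=> /(_ (fun n => sqr_ge0 _)) h; apply: sums_leW; last apply: h; last first.
  move=> n; rewrite !inE negb_or => /andP[n2 n1]; apply/eqP; rewrite sqrf_eq0 nm_eq0.
  have [kn|nk] := leP k n.
    rewrite -(jpsi n kn) /jac /g.
    have -> : k - 1 <= n - 1 by lia.
    have -> : k - 1 <= n + 1 by lia.
    by have -> : k - 1 <= n by lia.
  rewrite /jac /g.
  have -> : (k - 1 <= n - 1) = false by lia.
  have -> : (k - 1 <= n + 1) = false by lia.
  have -> : (k - 1 <= n) = false by lia.
  by rewrite !mulr0 !addr0.
rewrite big_cons big_seq1 /jac /g.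
have -> : (k - 1 <= k - 2 - 1) = false by lia.
have -> : (k - 1 <= k - 2) = false by lia.
have -> : (k - 1 <= k - 1 - 1) = false by lia.
have -> : k - 2 + 1 = k - 1 by lia.
have -> : k - 1 + 1 = k by lia.
have -> : k - 1 <= k by lia.
rewrite lexx !mulr0 !add0r addr0.
have sqM (x : R[i]) : nm x <= M -> nm x ^+ 2 <= M ^+ 2.
  by move=> xM; rewrite ler_sqr ?nnegrE ?normc_ge0.
have /le_trans -> // : nm (al (k - 2) * psi (k - 1)) ^+ 2 +
   nm (al (k - 1) * psi k + be (k - 1) * psi (k - 1)) ^+ 2 <=
   M ^+ 2 * nm (psi (k - 1)) ^+ 2 + (2 * (M ^+ 2 * nm (psi k) ^+ 2) +
   2 * (M ^+ 2 * nm (psi (k - 1)) ^+ 2)).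
  rewrite lerD//; last apply: le_trans (nm_sqrD _ _) _;
    by rewrite !Normc.normcM !exprMn ?lerD// ?ler_wpM2l// ler_wpM2r ?sqr_ge0// sqM.
have := sqr_ge0 (M * nm (psi k)); rewrite exprMn; lra.
Qed.

(** Let [e j] be the squared norm of the pair at [j], and K1 the constant of [forward_bound]. That
    bound started at [j] gives e N <= K1 e j for each j <= N; started at 0, it bounds the sum of the
    [e j] by 2 K1 e 0. Adding the first inequality over [j] yields the factor N + 1. *)
Lemma forward_decay psi (N : nat) K : l2_le psi K ->
  (forall n, 0 <= n -> jac al be psi n = 0) ->
  N.+1%:R * (nm (psi N) ^+ 2 + nm (psi (N%:Z - 1)) ^+ 2) <=
  2 * (3 * C * M ^+ 2) ^+ 2 * (nm (psi 0) ^+ 2 + nm (psi (- 1)) ^+ 2).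
Proof.
move=> psiK jpsi; set K1 := 3 * C * M ^+ 2.
have K10 : 0 <= K1 by rewrite mulr_ge0 ?sqr_ge0// mulr_ge0.
pose e (j : nat) := nm (psi j) ^+ 2 + nm (psi (j%:Z - 1)) ^+ 2.
have eN j : (j <= N)%N -> e N <= K1 * e j.
  move=> jN; have := @forward_bound psi j K psiK.
  move=> /(_ (fun n jn => jpsi n (le_trans (le0z_nat _) jn))) /(_ [:: N%:Z; N%:Z - 1]).
  rewrite big_cons big_seq1 /= inE.
  have -> : (j%:Z - 1 <= N) by lia.
  have -> : (j%:Z - 1 <= N%:Z - 1) by lia.
  by apply; lia.
have es : \sum_(j <- iota 0 N.+1) e j <= 2 * (K1 * e 0%N).
  rewrite big_split mulr_natl mulr2n /=.
  have fb := @forward_bound psi 0 K psiK jpsi.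
  apply: lerD.
    have := fb [seq j%:Z | j <- iota 0 N.+1]; rewrite big_map.
    rewrite map_inj_uniq ?iota_uniq; last by move=> x y [].
    rewrite (eq_bigr (fun j : nat => nm (psi j) ^+ 2)); first by apply.
    by [].
  have := fb [seq j%:Z - 1 | j <- iota 0 N.+1]; rewrite big_map.
  rewrite map_inj_uniq ?iota_uniq; last by move=> x y; lia.
  rewrite (eq_bigr (fun j : nat => nm (psi (j%:Z - 1)) ^+ 2)); first by apply.
  by move=> j _; rewrite ifT//; lia.
apply: (@le_trans _ _ (\sum_(j <- iota 0 N.+1) K1 * e j)).
  rewrite -/(e N) -[leLHS]mulr1.
  have -> : N.+1%:R * e N * 1 = \sum_(j <- iota 0 N.+1) e N.
    by rewrite big_const_seq count_predT size_iota iter_addr addr0 mulr1 mulr_natl.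
  rewrite big_seq [leRHS]big_seq; apply: ler_sum => j.
  by rewrite mem_iota => /andP[_ jN]; apply: eN; lia.
rewrite -mulr_sumr.
apply: le_trans (ler_wpM2l K10 es) _.
by rewrite /e sub0r le_eqVlt; apply/orP; left; apply/eqP; ring.
Qed.

End forward.

(* n |-> -1 - n exchanges the two half-lines and swaps psi 0 and psi (-1). *)
Definition refl f n := f (- 1 - n).
Definition reflc al n := conjc (al (- 2 - n)).

Lemma jac_refl al be f n :
  jac (reflc al) (refl be) (refl f) n = jac al be f (- 1 - n).
Proof.
rewrite /jac /reflc /refl conjcK.
have -> : - 2 - (n - 1) = - 1 - n by lia.
have -> : - 1 - (n - 1) = - 1 - n + 1 by lia.
have -> : - 1 - (n + 1) = - 1 - n - 1 by lia.
have -> : - 2 - n = - 1 - n - 1 by lia.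
by rewrite [X in X + _]addrC.
Qed.

Lemma refl_inj : injective (fun n => - 1 - n).
Proof. by move=> x y; lia. Qed.

Lemma reflK f n : refl (refl f) n = f n.
Proof. by rewrite /refl; congr f; lia. Qed.

Lemma coercive_refl al be C : coercive al be C -> coercive (reflc al) (refl be) C.
Proof.
move=> co f K0 K fK0 jfK.
have := co (refl f) K0 K (l2_le_inj refl_inj fK0).
have jE n : jac al be (refl f) n = jac (reflc al) (refl be) f (- 1 - n).
  have := jac_refl al be (refl f) (- 1 - n).
  have -> : - 1 - (- 1 - n) = n by lia.
  by move=> <-; rewrite /jac !reflK.
have -> : jac al be (refl f) = fun n => jac (reflc al) (refl be) f (- 1 - n).
  exact/funext.
move=> /(_ (l2_le_inj refl_inj jfK)) /(l2_le_inj refl_inj).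
have -> // : (fun n => refl f (- 1 - n)) = f.
  by apply/funext => n; exact: (reflK f n).
Qed.

Lemma reflcK al n : reflc (reflc al) n = al n.
Proof. by rewrite /reflc conjcK; congr al; lia. Qed.

Definition shift k f n := f (n + k).

Lemma jac_shift al be f k n :
  jac (shift k al) (shift k be) (shift k f) n = jac al be f (n + k).
Proof.
rewrite /jac /shift.
have -> : n - 1 + k = n + k - 1 by lia.
by have -> : n + 1 + k = n + k + 1 by lia.
Qed.

Lemma l2_shift f K k : l2_le f K -> l2_le (shift k f) K.
Proof. by apply: l2_le_inj => x y; exact: addIr. Qed.

Lemma coercive_shift al be C k : coercive al be C ->
  coercive (shift k al) (shift k be) C.
Proof.
move=> co f K0 K fK0 jfK.
have fE : f = shift k (shift (- k) f).
  by apply/funext => n; rewrite /shift addrK.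
have := co (shift (- k) f) K0 K (l2_shift _ fK0).
have -> : jac al be (shift (- k) f) = shift (- k) (jac (shift k al) (shift k be) f).
  by apply/funext => n; rewrite {2}fE [RHS]jac_shift subrK.
by move=> /(_ (l2_shift _ jfK)) /(l2_shift k); rewrite -fE.
Qed.

(* Vectors (psi 0, psi (-1)) of solutions that are square summable at +oo,
   respectively -oo. *)
Definition stable al be (x y : R[i]) := exists psi, [/\ exists K, l2_le psi K,
  forall n, 0 <= n -> jac al be psi n = 0, psi 0 = x & psi (- 1) = y].

Definition unstable al be (x y : R[i]) := exists psi, [/\ exists K, l2_le psi K,
  forall n, n < 0 -> jac al be psi n = 0, psi 0 = x & psi (- 1) = y].

Lemma unstable_refl al be x y :
  unstable al be x y <-> stable (reflc al) (refl be) y x.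
Proof.
split=> [[psi [[K psiK] jpsi p0 p1]]|[psi [[K psiK] jpsi p0 p1]]];
  exists (refl psi); split => //; try by exists K; exact: l2_le_inj refl_inj psiK.
- by move=> n n0; rewrite jac_refl jpsi//; lia.
- move=> n n0; have := jac_refl al be (refl psi) (- 1 - n).
  have -> : - 1 - (- 1 - n) = n by lia.
  move=> <-; rewrite /jac !reflK -/(jac _ _ _ _) jpsi//; lia.
Qed.

Lemma stable_refl al be x y :
  stable al be x y <-> unstable (reflc al) (refl be) y x.
Proof.
rewrite unstable_refl.
have -> : reflc (reflc al) = al by apply/funext => n; exact: reflcK.
by have -> : refl (refl be) = be by apply/funext => n; exact: reflK.
Qed.

Lemma stable_lin al be x y x' y' (c d : R[i]) : stable al be x y ->
  stable al be x' y' -> stable al be (c * x + d * x') (c * y + d * y').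
Proof.
move=> [f [[K fK] jf <- <-]] [g [[L gL] jg <- <-]].
exists (fun n => c * f n + d * g n); split=> //.
  by eexists; exact: l2_leD (l2_leZ c fK) (l2_leZ d gL).
by move=> n n0; rewrite jacD !jacZ jf// jg// !mulr0 addr0.
Qed.

(** The two half-line solutions agree at -1 and 0, so together they form an l^2 solution on the
    whole line, which coercivity forces to vanish. *)
Lemma stable_unstable0 al be C x y : coercive al be C ->
  stable al be x y -> unstable al be x y -> x = 0 /\ y = 0.
Proof.
move=> co [f [[K fK] jf f0 f1]] [g [[L gL] jg g0 g1]].
pose h n := if n < 0 then g n else f n.
have hKL : l2_le h (K + L).
  apply: le_sums_le (sums_leD fK gL) => n; rewrite /h.
  by case: ifP => _; rewrite ?lerDl ?lerDr sqr_ge0.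
have jh n : jac al be h n = 0.
  have [n0|n0] := ltP n 0.
    rewrite -(jg n n0) /jac /h n0 (_ : n - 1 < 0); last by lia.
    case: ifPn => // n1; have -> : n = - 1 by lia.
    by rewrite addNr f0 g0.
  rewrite -(jf n n0) /jac /h (_ : (n < 0) = false); last by lia.
  rewrite (_ : (n + 1 < 0) = false); last by lia.
  case: ifPn => // n1; have -> : n = 0 by lia.
  by rewrite sub0r f1 g1.
split; first by rewrite -f0; have := coercive_eq0 co hKL jh 0; rewrite /h ltxx.
by rewrite -g1; have := coercive_eq0 co hKL jh (- 1).
Qed.

(** Two independent stable vectors would span the plane, hence also the nonzero unstable vector,
    against [stable_unstable0]. The coefficients are those of Cramer's rule. *)
Lemma stable_det al be C x y x' y' z w : coercive al be C ->
  unstable al be z w -> (z != 0) || (w != 0) ->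
  stable al be x y -> stable al be x' y' -> x * y' = x' * y.
Proof.
move=> co uzw zw0 sxy sxy'; apply/eqP; rewrite -subr_eq0; apply/negPn/negP => D0.
have := stable_lin ((z * y' - x' * w) / (x * y' - x' * y))
                   ((x * w - z * y) / (x * y' - x' * y)) sxy sxy'.
set z' := (X in stable _ _ X _); set w' := (X in stable _ _ _ X).
have -> : z' = z by rewrite /z'; field.
have -> : w' = w by rewrite /w'; field.
move=> /(stable_unstable0 co) /(_ uzw)[z0 w0].
by move: zw0; rewrite z0 w0 eqxx.
Qed.

Lemma unstable_det al be C x y x' y' z w : coercive al be C ->
  stable al be z w -> (z != 0) || (w != 0) ->
  unstable al be x y -> unstable al be x' y' -> x * y' = x' * y.
Proof.
move=> /coercive_refl co /stable_refl zw; rewrite orbC => zw0.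
move=> /unstable_refl xy /unstable_refl xy'.
by rewrite mulrC [RHS]mulrC (stable_det co zw zw0 xy xy').
Qed.

(** The shifted solution is multiplied by [al 0], so that its entry at 0 can be read off the
    equation at site 0 without a division. *)
Lemma stable_step al be x y : stable al be x y ->
  stable (shift 1 al) (shift 1 be)
    (- be 0 * x - conjc (al (- 1)) * y) (al 0 * x).
Proof.
move=> [f [[K fK] jf <- <-]]; exists (fun n => al 0 * shift 1 f n); split.
- by eexists; exact: l2_leZ (l2_shift _ fK).
- by move=> n n0; rewrite jacZ jac_shift jf ?mulr0//; lia.
- have := jf 0 (lexx _); rewrite /jac /shift sub0r !add0r => h.
  by apply/eqP; rewrite -subr_eq0 -h; apply/eqP; ring.
- by rewrite /shift addNr.
Qed.

(** The solution at -oo satisfies no equation at site 0, so [f 1] is arbitrary. A multiple of a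
    delta replaces it by the value [t] that makes the equation at the old site 0 hold after
    multiplication by [al 0]. *)
Lemma unstable_step al be x y : unstable al be x y ->
  unstable (shift 1 al) (shift 1 be)
    (- be 0 * x - conjc (al (- 1)) * y) (al 0 * x).
Proof.
move=> [f [[K fK] jf <- <-]]; set t := _ - _.
exists (fun n => al 0 * shift 1 f n + (t - al 0 * f 1) * (n == 0)%:R); split.
- by eexists; exact: l2_leD (l2_leZ _ (l2_shift 1 fK)) (l2_leZ _ (l2_le_delta 0)).
- move=> n n0; rewrite jacD !jacZ jac_shift /jac /shift.
  have -> : (n == 0) = false by lia.
  have -> : (n - 1 == 0) = false by lia.
  rewrite !mulr0 addr0 add0r.
  have [n1|n1] := eqVneq n (- 1); last first.
    have -> : (n + 1 == 0) = false by lia.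
    by rewrite -/(jac al be f (n + 1)) jf ?mulr0 ?addr0//; lia.
  by rewrite n1 addNr eqxx sub0r add0r mulr1 /t; ring.
- by rewrite eqxx mulr1 /shift add0r addrC subrK.
- by rewrite (_ : (- 1 == 0 :> int) = false)// mulr0 addr0 /shift addNr.
Qed.

(** If the cocycle kills the vector, the solution cut off to the right of 0 still solves the
    equation everywhere: the two hypotheses are the equations at 0 and, up to conjugation of [al 0],
    at 1. Hence the cocycle is injective on unstable vectors even where [al] vanishes. *)
Lemma unstable_step_eq0 al be C x y : coercive al be C -> unstable al be x y ->
  - be 0 * x - conjc (al (- 1)) * y = 0 -> al 0 * x = 0 -> x = 0 /\ y = 0.
Proof.
move=> co [f [[K fK] jf f0 f1]] h1 h2.
pose g n := if n <= 0 then f n else 0.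
have gK : l2_le g K.
  apply: le_sums_le fK => n; rewrite /g; case: ifP => // _.
  by rewrite Normc.normc0 expr0n sqr_ge0.
have jg n : jac al be g n = 0.
  have [n0|n0] := ltP n 0.
    rewrite -(jf n n0) /jac /g (ltW n0).
    have -> : n - 1 <= 0 by lia.
    by have -> : n + 1 <= 0 by lia.
  rewrite /jac /g; have -> : (n + 1 <= 0) = false by lia.
  have [n1|n1] := leP n 0.
    have -> : n = 0 by lia.
    change (conjc (al (- 1)) * f (- 1) + al 0 * 0 + be 0 * f 0 = 0).
    rewrite f0 f1.
    transitivity (- (- be 0 * x - conjc (al (- 1)) * y)); first by ring.
    by rewrite h1 oppr0.
  rewrite !mulr0 !addr0; case: ifP => n2; last by rewrite mulr0.
  have -> : n = 1 by lia.
  rewrite subrr f0; apply/eqP; move/eqP: h2; rewrite -!nm_eq0 !Normc.normcM.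
  by rewrite nm_conj.
have h := coercive_eq0 co gK jg.
by rewrite -f0 -f1; split; [have := h 0|have := h (- 1)].
Qed.

(* If the columns of the Green function with poles -1 and -2 both vanish at
   -1 and 0, then those with poles -1 and 0 are solutions at -oo with nonzero
   Wronskian, which is impossible. *)
Lemma green_stable al be C M : coercive al be C ->
  (forall n, nm (al n) <= M) ->
  (forall m, exists g K, l2_le g K /\ forall n, jac al be g n = (n == m)%:R) ->
  exists x y, ((x != 0) || (y != 0)) /\ stable al be x y.
Proof.
move=> co alM green.
have [g [Kg [gK jg]]] := green (- 1).
have [h [Kh [hK jh]]] := green (- 2).
have [k [Kk [kK jk]]] := green 0.
have [g0|] := boolP ((g 0 != 0) || (g (- 1) != 0)).
  exists (g 0), (g (- 1)); split => //; exists g; split => //; first by exists Kg.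
  by move=> n n0; rewrite jg; have -> : (n == - 1) = false by lia.
have [h0 _|] := boolP ((h 0 != 0) || (h (- 1) != 0)).
  exists (h 0), (h (- 1)); split => //; exists h; split => //; first by exists Kh.
  by move=> n n0; rewrite jh; have -> : (n == - 2) = false by lia.
rewrite !negb_or !negbK => /andP[/eqP h0 /eqP h1] /andP[/eqP g0 /eqP g1]; exfalso.
have cg : conjc (al (- 2)) * g (- 2) = 1.
  have := jg (- 1); rewrite /jac eqxx addNr g0 g1 !mulr0 !addr0.
  by have -> : - 1 - 1 = - 2 :> int by lia.
(* The coefficients are the entries of [jac] applied to the delta at -1, at the sites -2, -1 and 0.
   So [F] is an l^2 solution, hence zero, and its value at -1 gives [ck]. *)
pose F n := al (- 2) * h n + be (- 1) * g n + conjc (al (- 1)) * k n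
  + (- 1) * (n == - 1)%:R.
have jF n : jac al be F n = 0.
  rewrite /F !jacD !jacZ jg jh jk /jac.
  have [->|n0] := eqVneq n 0.
    rewrite sub0r add0r eqxx /= !mulr0 mulr1; ring.
  have [->|n1] := eqVneq n (- 1).
    rewrite addNr (_ : - 1 - 1 = - 2 :> int) ?eqxx//=; ring.
  have [->|n2] := eqVneq n (- 2).
    rewrite (_ : - 2 + 1 = - 1 :> int) ?eqxx//=; ring.
  have -> : (n - 1 == - 1) = false by lia.
  have -> : (n + 1 == - 1) = false by lia.
  have -> : (false%:R : R[i]) = 0 by [].
  by rewrite !(mulr0, addr0).
have ck : conjc (al (- 1)) * k (- 1) = 1.
  have := coercive_eq0 co (l2_leD (l2_leD (l2_leD (l2_leZ _ hK) (l2_leZ _ gK))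
    (l2_leZ _ kK)) (l2_leZ _ (l2_le_delta _))) jF (- 1).
  rewrite /F h1 g1 eqxx !mulr0 !add0r mulr1 => /eqP.
  by rewrite subr_eq0 => /eqP.
(* The Wronskian of [g] and [k]. Only its modulus is constant for n <= -2, since one step replaces
   [al (n - 1)] by its conjugate. It is nonzero at -2 by [cg] and [ck], while square summability of
   [g] and [k] makes it summable. *)
pose W n := al n * (g (n + 1) * k n - g n * k (n + 1)).
have WS n : n <= - 2 -> nm (W n) = nm (W (n - 1)).
  move=> n2; have := jg n; have := jk n.
  have -> : (n == - 1) = false by lia.
  have -> : (n == 0) = false by lia.
  rewrite /jac => kn gn.
  have -> : W n = - conjc (al (n - 1)) * (g (n - 1) * k n - g n * k (n - 1)).
    rewrite /W; apply/eqP; rewrite -subr_eq0; apply/eqP.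
    transitivity ((conjc (al (n - 1)) * g (n - 1) + al n * g (n + 1) + be n * g n)
      * k n - g n * (conjc (al (n - 1)) * k (n - 1) + al n * k (n + 1) + be n * k n)).
      by ring.
    by rewrite gn kn mulr0 mul0r subrr.
  rewrite /W subrK Normc.normcM nmN nm_conj Normc.normcM -(nmN (_ - _)) opprB.
  by [].
have Wc (j : nat) : nm (W (- 2 - j%:Z)) = nm (W (- 2)).
  elim: j => [|j <-]; first by rewrite subr0.
  rewrite [RHS]WS; last by lia.
  by congr (nm (W _)); lia.
have W2 : 0 < nm (W (- 2)).
  rewrite nm_gt0 /W (_ : - 2 + 1 = - 1 :> int)// g1 mul0r sub0r.
  rewrite mulf_neq0//; last rewrite oppr_eq0 mulf_neq0//.
  - by apply: contra_eq_neq cg => ->; rewrite conjc0 mul0r eq_sym oner_eq0.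
  - by apply: contra_eq_neq cg => ->; rewrite mulr0 eq_sym oner_eq0.
  - by apply: contra_eq_neq ck => ->; rewrite mulr0 eq_sym oner_eq0.
have M0 : 0 <= M := le_trans (normc_ge0 _) (alM 0).
have := sums_leZ M0 (sums_leD (sums_leD (l2_shift 1 gK) gK)
                               (sums_leD (l2_shift 1 kK) kK)).
move=> /(@sums_le_const _ _ _ (nm (W (- 2))) (fun j : nat => - 2 - j%:Z)).
suff: nm (W (-2)) <= 0 -> False by move=> WF H; apply/WF/H => [x y|j]; [lia|];
  rewrite -(Wc j) /W Normc.normcM; apply: ler_pM; rewrite ?normc_ge0//;
  apply: le_trans (nmB _ _) _; rewrite !Normc.normcM /shift;
  set a := nm (g _); set b := nm (k _); set c := nm (g _); set d := nm (k _);
  have := sqr_ge0 (a - b); have := sqr_ge0 (c - d); have := sqr_ge0 a;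
  have := sqr_ge0 b; have := sqr_ge0 c; have := sqr_ge0 d; lra.
lra.
Qed.

Section domination.
Variables (al be : int -> R[i]).

Fixpoint transfer (N : nat) (v : R[i] * R[i]) : R[i] * R[i] :=
  if N is m.+1 then
    let w := transfer m v in
    (- be m * w.1 - conjc (al (m%:Z - 1)) * w.2, al m * w.1)
  else v.

Definition sqnorm (v : R[i] * R[i]) : R := nm v.1 ^+ 2 + nm v.2 ^+ 2.

Lemma transferZ N (c : R[i]) x y : transfer N (c * x, c * y) =
  (c * (transfer N (x, y)).1, c * (transfer N (x, y)).2).
Proof. by elim: N => //= N ->/=; congr pair; ring. Qed.

(** By the equation at site [n], one step sends the pair at [n] to [al n] times the pair at
    [n + 1]. *)
Lemma transfer_sol N psi : (forall n, 0 <= n < N%:Z -> jac al be psi n = 0) ->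
  transfer N (psi 0, psi (- 1)) =
  ((\prod_(i < N) al i) * psi N, (\prod_(i < N) al i) * psi (N%:Z - 1)).
Proof.
elim: N => [|N IH] jpsi /=; first by rewrite big_ord0 !mul1r sub0r.
rewrite IH; last by move=> n /andP[n0 nN]; apply: jpsi; lia.
rewrite big_ord_recr /=; have := jpsi N; rewrite /jac.
have -> : N%:Z + 1 = N.+1 by lia.
have -> : N.+1%:Z - 1 = N by lia.
move=> /(_ _) h; have {}h := h ltac:(lia).
congr pair; last by ring.
apply/eqP; rewrite -subr_eq0; apply/eqP.
transitivity (- (\prod_(i < N) al i) * (conjc (al (N%:Z - 1)) * psi (N%:Z - 1)
  + al N * psi N.+1 + be N * psi N)); first by ring.
by rewrite h mulr0.
Qed.

Variables (C M : R).
Hypothesis co : coercive al be C.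

Lemma unstable_transfer N x y : unstable al be x y -> (x != 0) || (y != 0) ->
  let w := transfer N (x, y) in
  unstable (shift N al) (shift N be) w.1 w.2 /\ ((w.1 != 0) || (w.2 != 0)).
Proof.
move=> uxy xy0; elim: N => [|N] /=.
  split => //; congr (unstable _ _ _ _): uxy; apply/funext => n;
  by rewrite /shift addr0.
set w := transfer N _ => -[uw w0].
have := unstable_step uw.
have E f : shift 1 (shift N f) = shift N.+1 f.
  by apply/funext => n; rewrite /shift; congr f; lia.
rewrite !E /shift add0r.
have -> : - 1 + N%:Z = N%:Z - 1 by lia.
split => //; have := unstable_step_eq0 (coercive_shift (k := N) co) uw.
rewrite /shift add0r (_ : - 1 + N%:Z = N%:Z - 1); last by lia.
have [->|//] := eqVneq (_ - _) 0; have [->|//] := eqVneq (_ * _) 0.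
by move=> /(_ erefl erefl)[w10 w20]; move: w0; rewrite w10 w20 eqxx.
Qed.

Hypotheses (C0 : 0 <= C).
Hypotheses (alM : forall n, nm (al n) <= M) (beM : forall n, nm (be n) <= M).

(** With [P] the product of the [al i], the image of [s] is [P] times the decaying solution at [N].
    The image [w] of [u] is unstable at [N], and the solution through it decays from [N] back to 0,
    where it equals [P] times [u]. Each comparison contributes a factor N + 1, and [P] is eliminated
    by bounding it, not by dividing. *)
Lemma transfer_domination N s u : stable al be s.1 s.2 -> unstable al be u.1 u.2 ->
  (s.1 != 0) || (s.2 != 0) -> sqnorm s = 1 -> sqnorm u = 1 ->
  N.+1%:R ^+ 2 * sqnorm (transfer N s) <=
  (2 * (3 * C * M ^+ 2) ^+ 2) ^+ 2 * sqnorm (transfer N u).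
Proof.
move=> ss uu s0 s1 u1; set K1 := 2 * (3 * C * M ^+ 2) ^+ 2.
have K10 : 0 <= K1 by rewrite mulr_ge0// sqr_ge0.
have u0 : (u.1 != 0) || (u.2 != 0).
  apply/negPn/negP; rewrite negb_or !negbK => /andP[/eqP u10 /eqP u20].
  by move/eqP: u1; rewrite /sqnorm u10 u20 Normc.normc0 expr0n addr0 eq_sym oner_eq0.
have [uw w0] := unstable_transfer N uu u0.
rewrite -surjective_pairing in uw w0.
set w := transfer N u in uw w0 *.
set P := \prod_(i < N) al i.
have sP : N.+1%:R * sqnorm (transfer N s) <= nm P ^+ 2 * K1.
  move: (ss) => [psi [[K psiK] jpsi p0 p1]].
  have := forward_decay C0 co alM beM N psiK jpsi.
  rewrite -/K1 p0 p1 -/(sqnorm s) s1 mulr1 => h.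
  rewrite [s]surjective_pairing -p0 -p1 transfer_sol; last first.
    by move=> n /andP[n0 _]; exact: jpsi.
  rewrite /sqnorm /= !Normc.normcM !exprMn -mulrDr mulrCA.
  by rewrite ler_wpM2l ?sqr_ge0.
move: uw => [f [[K fK] jf f0 f1]].
(* The solution through [w], moved back to the original indexing: it satisfies the equation at all
   sites below [N]. *)
pose phi := shift (- N%:Z) f.
have jphi n : n < N%:Z -> jac al be phi n = 0.
  move=> nN; have := jac_shift al be phi N (n - N%:Z).
  have -> : shift N phi = f by apply/funext => m; rewrite /phi /shift addrK.
  by rewrite subrK => <-; apply: jf; lia.
have uphi : unstable al be (phi 0) (phi (- 1)).
  exists phi; split=> //; first by exists K; exact: l2_shift.
  by move=> n n0; apply: jphi; lia.
have detphi := unstable_det co ss s0 uphi uu.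
(* The solution through w at N starts at c u; comparison at N gives c = P. *)
have [c [c1 c2]] : exists c, phi 0 = c * u.1 /\ phi (- 1) = c * u.2.
  have [u10|u10] := eqVneq u.1 0.
    have u20 : u.2 != 0 by move: u0; rewrite u10 eqxx.
    exists (phi (- 1) / u.2); rewrite divfK// u10 mulr0; split => //.
    by apply/eqP; move/eqP: detphi; rewrite u10 mul0r mulf_eq0 (negPf u20) orbF.
  exists (phi 0 / u.1); rewrite divfK//; split => //.
  by rewrite mulrAC detphi mulrAC divff// mul1r.
have := @transfer_sol N phi.
move=> /(_ (fun n => _)) h; have {h} := h (fun n nN => jphi n (proj2 (andP nN))).
rewrite c1 c2 transferZ -surjective_pairing -/w -/P.
have -> : phi N = w.1 by rewrite /phi /shift subrr.
have -> : phi (N%:Z - 1) = w.2 by rewrite /phi /shift -f1; congr f; lia.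
move=> [cw1 cw2].
have cP : c = P.
  have [w10|w10] := eqVneq w.1 0; last exact: (mulIf w10).
  by move: w0; rewrite w10 eqxx /= => /mulIf; exact.
have uP : N.+1%:R * nm P ^+ 2 <= K1 * sqnorm w.
  have co' := coercive_refl (coercive_shift (k := N) co).
  have al' n : nm (reflc (shift N al) n) <= M by rewrite nm_conj; exact: alM.
  have be' n : nm (refl (shift N be) n) <= M by exact: beM.
  have := forward_decay C0 co' al' be' N (l2_le_inj refl_inj fK : l2_le (refl f) K).
  have jr n : 0 <= n -> jac (reflc (shift N al)) (refl (shift N be)) (refl f) n = 0.
    by move=> n0; rewrite jac_refl jf//; lia.
  move=> /(_ jr); rewrite -/K1 /refl.
  have -> : - 1 - (0 : int) = - 1 by lia.
  have -> : - 1 - (- 1) = 0 :> int by lia.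
  rewrite f0 f1 [nm w.2 ^+ 2 + _]addrC -/(sqnorm w).
  have -> : f (- 1 - N%:Z) = phi (- 1) by [].
  have -> : f (- 1 - (N%:Z - 1)) = phi 0 by rewrite /phi /shift; congr f; lia.
  rewrite c1 c2 !Normc.normcM !exprMn -mulrDr [_ + nm u.1 ^+ 2]addrC -/(sqnorm u).
  by rewrite u1 mulr1 cP.
rewrite expr2 -mulrA; apply: (@le_trans _ _ (N.+1%:R * (nm P ^+ 2 * K1))).
  by rewrite ler_wpM2l.
have := ler_wpM2l K10 uP; lra.
Qed.

End domination.

End jacobi_sequences.

(** * Closed conditions, and compactness for pointwise convergence *)

Section closed_conditions.
Variables (R : realType) (X : topologicalType).

Lemma closed_preimage (Y : topologicalType) (f : X -> Y) (D : set Y) :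
  continuous f -> closed D -> closed [set x | D (f x)].
Proof. by move=> cf cD; have := preimage_closed _ cD; apply=> x _; exact: cf. Qed.

Lemma closed_fun_le (f : X -> R) c : continuous f -> closed [set x | f x <= c].
Proof. by move=> cf; exact: (closed_preimage cf (@closed_le R c)). Qed.

Lemma closed_fun_eq (f : X -> R) c : continuous f -> closed [set x | f x = c].
Proof. by move=> cf; exact: (closed_preimage cf (@closed_eq R c)). Qed.

Lemma closed_fun_eq0 (f : X -> R[i]) : continuous f -> closed [set x | f x = 0].
Proof.
move=> cf; have -> : [set x | f x = 0] = [set x | (nm (f x) : R) = 0].
  by apply/seteqP; split=> x /= => [->|/eqP]; [exact: Normc.normc0|rewrite nm_eq0 => /eqP].
exact: closed_fun_eq (nm_comp_continuous cf).
Qed.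

Lemma continuous_nm_sqr (f : X -> R[i]) : continuous f ->
  continuous (fun x => nm (f x) ^+ 2 : R).
Proof.
move=> /nm_comp_continuous cf x; exact: (cvgM (cf x) (cf x)).
Qed.

Lemma continuous_sum (F : int -> X -> R) s : (forall i, continuous (F i)) ->
  continuous (fun x => \sum_(i <- s) F i x).
Proof.
move=> cF; elim: s => [|i s IH].
  have -> : (fun x => \sum_(i <- [::]) F i x) = fun=> 0.
    by apply/funext => x; rewrite big_nil.
  by move=> x; exact: cvg_cst.
have -> : (fun x => \sum_(j <- i :: s) F j x) = fun x => F i x + \sum_(j <- s) F j x.
  by apply/funext => x; rewrite big_cons.
by move=> x; exact: (cvgD (cF i x) (IH x)).
Qed.

Lemma continuous_sqnorm (f : X -> R[i] * R[i]) :
  continuous (fun x => (f x).1) -> continuous (fun x => (f x).2) ->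
  continuous (fun x => sqnorm (f x)).
Proof.
move=> /continuous_nm_sqr c1 /continuous_nm_sqr c2 x; exact: (cvgD (c1 x) (c2 x)).
Qed.

Lemma continuous_jac (al be f : X -> int -> R[i]) n :
  (forall n, continuous (al ^~ n)) -> (forall n, continuous (be ^~ n)) ->
  (forall n, continuous (f ^~ n)) -> continuous (fun x => jac (al x) (be x) (f x) n).
Proof.
move=> cal cbe cf x.
have cc : continuous (fun x => conjc (al x (n - 1))).
  by move=> y; apply: (@cvg_comp _ _ _ (al ^~ (n - 1)) (@conjc R));
    [exact: cal|exact: conjc_continuous].
exact: (cvgD (cvgD (cvgM (cc x) (cf _ x)) (cvgM (cal _ x) (cf _ x)))
  (cvgM (cbe _ x) (cf _ x))).
Qed.

Lemma near_nm_lt (f : X -> R[i]) (x : X) (c : R) : continuous f -> nm (f x) < c ->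
  \forall y \near x, nm (f y) < c.
Proof. by move=> /nm_comp_continuous cf fc; move: (cf x) => /cvgr_lt; apply. Qed.

Lemma near_nm_gt (f : X -> R[i]) (x : X) (c : R) : continuous f -> c < nm (f x) ->
  \forall y \near x, c < nm (f y).
Proof. by move=> /nm_comp_continuous cf fc; move: (cf x) => /cvgr_gt; apply. Qed.

End closed_conditions.

Section compactness.
Variable R : realType.

Lemma compact_disk (M : R) : compact [set z : R[i] | nm z <= M].
Proof.
pose c (p : R * R) : R[i] := Complex p.1 p.2.
have cc : continuous c.
  move=> p A /nbhs_ballP[_ /= /complex_gt0[e1 e10 ->] eA].
  apply/nbhs_ballP; exists (e1 / 2) => /=; first by rewrite divr_gt0.
  move=> q [/= q1 q2]; apply: eA; rewrite /ball /= Defs.normcE ltcR.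
  have -> : c p - c q = Complex (p.1 - q.1) 0 + Complex 0 (p.2 - q.2).
    by rewrite /c; apply/eqP; rewrite eq_complex /= addr0 add0r !eqxx.
  apply: le_lt_trans (nmD _ _) _.
  rewrite /= expr0n /= addr0 add0r !sqrtr_sqr.
  by move: q1 q2; rewrite /ball /=; lra.
have cK := continuous_compact (continuous_subspaceT cc)
  (compact_setX (@segment_compact R (- M) M) (@segment_compact R (- M) M)).
apply: (subclosed_compact _ cK).
  by apply: closed_fun_le; apply: (@nm_comp_continuous R _ id) => x; exact: cvg_id.
move=> [x y] /= xyM; exists (x, y) => //=; split => /=; rewrite in_itv /= -ler_norml;
  apply: le_trans xyM; rewrite -sqrtr_sqr ler_sqrt ?lerDl ?lerDr ?sqr_ge0//;
  by rewrite addr_ge0 ?sqr_ge0.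
Qed.

Definition seqs := prod_topology (fun _ : int => R[i]).

Lemma compact_seqs (M : R) : compact [set f : seqs | forall n, nm (f n) <= M].
Proof. exact: (@tychonoff _ (fun _ : int => R[i]) _ (fun _ => @compact_disk M)). Qed.

Lemma eval_continuous n : continuous (fun f : seqs => f n : R[i]).
Proof. exact: (@proj_continuous int (fun _ => R[i]) n). Qed.

(** Each finite sum is continuous for pointwise convergence, and the ball is an intersection over
    finite lists. *)
Lemma closed_l2_le (K : R) : closed [set f : seqs | l2_le f K].
Proof.
have -> : [set f : seqs | l2_le f K] = \bigcap_(s in [set s | uniq s])
    [set f : seqs | \sum_(i <- s) nm (f i) ^+ 2 <= K].
  by apply/seteqP; split=> f /=.
apply: closed_bigI => s _; apply: closed_fun_le.
apply: (@continuous_sum _ _ (fun i (f : seqs) => nm (f i) ^+ 2)) => i.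
exact: (continuous_nm_sqr (@eval_continuous i)).
Qed.

(** A closed subset of a product of disks. The radius [K + 1] works because K <= (K + 1)^2, which
    spares a square root. *)
Lemma compact_l2_le (K : R) : compact [set f : seqs | l2_le f K].
Proof.
apply: subclosed_compact (@compact_seqs (K + 1)) _; first exact: closed_l2_le.
move=> f fK n /=; have := sums_le_term n fK; have := normc_ge0 (f n).
have K0 := sums_le_ge0 fK => x0 xK; rewrite leNgt; apply/negP => h.
have : (K + 1) * (K + 1) <= nm (f n) * nm (f n) by apply: ler_pM; lra.
by rewrite -expr2 in xK *; have := sqr_ge0 K; lra.
Qed.

End compactness.

(** * The projective line *)

Section projective_line.
Variable R : realType.

(** An equation of the line, where [line] gives a generator; in this form incidence is seen to be
    closed. *)
Definition on_line (z : CP1 R) (v : R[i] * R[i]) : Prop :=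
  match z with Some z => v.2 = z * v.1 | None => v.1 = 0 end.

Lemma on_lineZ z (c : R[i]) v : on_line z v -> on_line z (c * v.1, c * v.2).
Proof. by case: z => [z|] /= ->; rewrite ?mulr0//; ring. Qed.

Lemma ord2_cases (i : 'I_2) : i = 0 \/ i = 1.
Proof. by case: i => [[|[|//]] ?]; [left|right]; exact: val_inj. Qed.

Lemma lineP (z : CP1 R) (v : 'cV[R[i]]_2) : line z v <-> on_line z (v 0 0, v 1 0).
Proof.
case: z => [z|] /=; split=> [[c _ <-]|h]; rewrite ?mxE/=.
- by rewrite mulr1 mulrC.
- exists (v 0 0) => //; apply/colP => i; rewrite !mxE.
  by have [->|->] := ord2_cases i; rewrite ?mulr1// h mulrC.
- by rewrite mulr0.
- exists (v 1 0) => //; apply/colP => i; rewrite !mxE.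
  by have [->|->] := ord2_cases i; rewrite ?mulr1// h mulr0.
Qed.

(** A unit vector determines its line continuously: at a finite point the slope is a continuous
    quotient, at infinity the slopes of nearby vectors leave every compact set. *)
Lemma on_line_nbhs (z : CP1 R) (v : R[i] * R[i]) (U : set (CP1 R)) :
  on_line z v -> sqnorm v = 1 -> nbhs z U ->
  \forall w \near v, sqnorm w = 1 -> forall z', on_line z' w -> U z'.
Proof.
have c1 : continuous (fun w : R[i] * R[i] => w.1) by move=> w; exact: cvg_fst.
have c2 : continuous (fun w : R[i] * R[i] => w.2) by move=> w; exact: cvg_snd.
case: z => [z|] /= zv v1 Uz.
  have v10 : v.1 != 0.
    apply/eqP => v10; move: v1; rewrite /sqnorm zv v10 mulr0 Normc.normc0 expr0n addr0.
    by move/eqP; rewrite eq_sym oner_eq0.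
  have cq : {for v, continuous (fun w : R[i] * R[i] => w.2 / w.1)}.
    by apply: cvgM; [exact: c2|apply: cvgV => //; exact: c1].
  have zE : v.2 / v.1 = z by rewrite zv mulfK.
  have : nbhs (v.2 / v.1) (Some @^-1` U) by rewrite zE.
  move=> /cq /= nq.
  have n1 : \forall w \near v, (0 : R) < nm w.1.
    have v1gt : 0 < nm v.1 by rewrite nm_gt0.
    exact: (near_nm_gt c1 v1gt).
  near=> w => _ [z'|] /=.
    have w10 : w.1 != 0 by rewrite -nm_gt0; near: w.
    move=> w2; have -> : z' = w.2 / w.1 by rewrite w2 mulfK.
    by near: w.
  by move=> /eqP; rewrite -nm_eq0 gt_eqF//; near: w.
have [K [cK _] KU] := Uz.
have [B KB] : exists B : R, forall y, K y -> nm y <= B.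
  have /compact_bounded : compact ((@Normc.normc R : R[i] -> R) @` K).
    apply: continuous_compact cK; apply: continuous_subspaceT; exact: nm_continuous.
  move=> [B [_ bB]]; exists (B + 1) => y Ky.
  have := bB (B + 1) _ (nm y); rewrite /= ger0_norm ?normc_ge0//.
  by apply; [rewrite ltrDl|exists y].
have v20 : 0 < nm v.2.
  rewrite nm_gt0; apply/eqP => v20; move: v1; rewrite /sqnorm zv v20 Normc.normc0.
  by rewrite expr0n addr0 => /eqP; rewrite eq_sym oner_eq0.
(* If |w.2| > e and |w.1| < e / B1, a slope of modulus at most [B < B1] is impossible, so the slope
   lies outside [K]. *)
pose e := nm v.2 / 2; have e0 : 0 < e by rewrite divr_gt0.
pose B1 := `|B| + 1; have B10 : 0 < B1 by rewrite ltr_pwDr.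
have n2 : \forall w \near v, e < nm w.2.
  have ev2 : e < nm v.2 by rewrite /e; lra.
  exact: (near_nm_gt c2 ev2).
have n1 : \forall w \near v, nm w.1 < e / B1.
  have ev1 : nm v.1 < e / B1 by rewrite zv Normc.normc0 divr_gt0.
  exact: (near_nm_lt c1 ev1).
near=> w => _ [z'|] /= w12; apply: KU; [left|by right].
exists z' => // /KB z'B.
have : e < nm w.2 by near: w.
have : nm w.1 < e / B1 by near: w.
rewrite ltr_pdivlMr// w12 Normc.normcM => h1; apply/negP; rewrite -leNgt.
apply: le_trans (ltW h1); rewrite mulrC ler_wpM2l ?normc_ge0//.
by rewrite /B1; have := ler_norm B; lra.
Unshelve. all: by end_near. Qed.

(** A closed graph argument carried out on the set of unit vectors lying on the lines. Its points
    over y <> x are separated from [x] by the Hausdorff property; those over [x] are handled by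
    [on_line_nbhs]. Compactness makes one neighbourhood of [x] serve for all of them. *)
Lemma graph_continuous (X : topologicalType) (l : X -> CP1 R) : hausdorff_space X ->
  (forall x, exists2 v, on_line (l x) v & sqnorm v = 1) ->
  compact [set p : X * (R[i] * R[i]) | on_line (l p.1) p.2 /\ sqnorm p.2 = 1] ->
  continuous l.
Proof.
move=> hX lne /compact_near_coveringP cov x U Ul.
have := cov X (nbhs x) (fun y q => q.1 = y -> on_line (l q.1) q.2 ->
  sqnorm q.2 = 1 -> U (l y)) _.
have H : forall p : X * (R[i] * R[i]), on_line (l p.1) p.2 /\ sqnorm p.2 = 1 ->
  \forall p' \near p & y \near x, p'.1 = y -> on_line (l p'.1) p'.2 ->
    sqnorm p'.2 = 1 -> U (l y).
  move=> [y v] /= [lv v1].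
  have [yx|yx] := eqVneq y x; last first.
    move: hX; rewrite open_hausdorff => /(_ _ _ yx)[[A B] /= [yA xB] [oA oB AB]].
    exists ([set p | A p.1], B).
      split => /=; last by apply: open_nbhs_nbhs; split=> //; rewrite inE in xB.
      have : nbhs y A by apply: open_nbhs_nbhs; split=> //; rewrite inE in yA.
      by move=> nA; exact: (@cvg_fst _ _ (nbhs y) (nbhs v) _ A nA).
    move=> [[y' v'] x'] /= [Ay' Bx'] yx'; exfalso; rewrite yx' in Ay'.
    by have : (A `&` B) x' by []; rewrite (eqP AB).
  have := on_line_nbhs lv v1; rewrite yx => /(_ _ Ul) nv.
  exists ([set p | sqnorm p.2 = 1 -> forall z', on_line z' p.2 -> U z'], setT).
    split; last exact: filterT.
    exact: (@cvg_snd _ _ (nbhs x) (nbhs v) _ _ nv).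
  by move=> [[y' v'] x'] /= [h _] <- lv' v'1; exact: (h v'1 _ lv').
move=> /(_ _ H) nU; apply: filterS nU => y /= nU.
have [v lv v1] := lne y; exact: (nU (y, v)).
Qed.

Lemma closed_on_line (X : topologicalType) (l : X -> CP1 R) : continuous l ->
  closed [set p : X * (R[i] * R[i]) | on_line (l p.1) p.2].
Proof.
have c1 : continuous (fun w : R[i] * R[i] => w.1) by move=> w; exact: cvg_fst.
have c2 : continuous (fun w : R[i] * R[i] => w.2) by move=> w; exact: cvg_snd.
move=> cl; rewrite -[X in closed X]setCK; apply: open_closedC.
rewrite openE => -[x v] /=; rewrite /interior /=.
case lx: (l x) => [z|] /= nlv.
  have cF : continuous (fun q : R[i] * (R[i] * R[i]) => q.2.2 - q.1 * q.2.1).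
    move=> q; apply: cvgB; last apply: cvgM.
    - by apply: (@cvg_comp _ _ _ snd snd); [exact: cvg_snd|exact: c2].
    - exact: cvg_fst.
    - by apply: (@cvg_comp _ _ _ snd fst); [exact: cvg_snd|exact: c1].
  have [[A B] /= [nA nB] AB] : \forall q \near (z, v), (0 : R) < nm (q.2.2 - q.1 * q.2.1).
    by apply: near_nm_gt => //; rewrite nm_gt0 subr_eq0; apply/eqP.
  exists ([set y | (Some @` A) (l y)], B); first split => //=.
    have : nbhs (l x) (Some @` A).
      by rewrite lx; exact: one_point_compactification_some_nbhs.
    by move=> /(cl x).
  move=> [y w] /= [[z' Az' <-] Bw] /= ly.
  by have := AB (z', w) (conj Az' Bw); rewrite /= ly subrr Normc.normc0 ltxx.
have v10 : 0 < nm v.1 by rewrite nm_gt0; apply/eqP.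
(* Near infinity: |w.1| > |v.1| / 2 and |w.2| < |v.2| + 1 allow no slope of modulus above [B]. *)
pose B := 2 * (nm v.2 + 1) / nm v.1.
exists ([set y | ((Some @` (~` [set z : R[i] | nm z <= B])) `|` [set None]) (l y)],
        [set w | nm v.1 / 2 < nm w.1 /\ nm w.2 < nm v.2 + 1]).
  split => /=.
    have : nbhs (l x)
        ((Some @` (~` [set z : R[i] | nm z <= B])) `|` [set None]).
      rewrite lx; exists [set z : R[i] | nm z <= B] => //.
      split; first exact: compact_disk.
      by apply: closed_fun_le; apply: (@nm_comp_continuous R _ id) => y; exact: cvg_id.
    by move=> /(cl x).
  apply: filterI.
    have h : nm v.1 / 2 < nm v.1 by lra.
    exact: (near_nm_gt c1 h).
  have h : nm v.2 < nm v.2 + 1 by lra.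
  exact: (near_nm_lt c2 h).
move=> [y w] /= [[[z' /= z'B <-]|->] [w1 w2]] /=; last first.
  by move=> w10; move: w1; rewrite w10 Normc.normc0; lra.
move=> ww; apply: z'B; rewrite /B ler_pdivlMr//.
move: w2; rewrite ww Normc.normcM => w2.
have := normc_ge0 z'; set a := nm z' in w2 *; nra.
Qed.

End projective_line.

Section product_continuity.
Variables X Y Z : topologicalType.

Lemma continuous_fst (f : X -> Y) : continuous f -> continuous (fun p : X * Z => f p.1).
Proof. by move=> cf p; apply: (@cvg_comp _ _ _ fst f); [exact: cvg_fst|exact: cf]. Qed.

Lemma continuous_snd (f : X -> Y) : continuous f -> continuous (fun p : Z * X => f p.2).
Proof. by move=> cf p; apply: (@cvg_comp _ _ _ snd f); [exact: cvg_snd|exact: cf]. Qed.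

Lemma continuous_pair (f : X -> Y) (g : X -> Z) : continuous f -> continuous g ->
  continuous (fun x => (f x, g x)).
Proof. by move=> cf cg x; exact: (cvg_pair (cf x) (cg x)). Qed.

End product_continuity.

Section normalization.
Variable R : realType.

Lemma sqnormZ (c : R[i]) v : sqnorm (c * v.1, c * v.2) = nm c ^+ 2 * sqnorm v.
Proof. by rewrite /sqnorm /= !Normc.normcM !exprMn mulrDr. Qed.

Lemma sqnorm_ge0 (v : R[i] * R[i]) : 0 <= sqnorm v.
Proof. by rewrite addr_ge0 ?sqr_ge0. Qed.

Lemma sqnorm_gt0 (v : R[i] * R[i]) : (0 < sqnorm v) = (v.1 != 0) || (v.2 != 0).
Proof.
rewrite lt_neqAle sqnorm_ge0 andbT eq_sym /sqnorm paddr_eq0 ?sqr_ge0//.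
by rewrite !sqrf_eq0 !nm_eq0 negb_and.
Qed.

Lemma normalize (v : R[i] * R[i]) : (v.1 != 0) || (v.2 != 0) ->
  exists2 c : R[i], c != 0 & sqnorm (c * v.1, c * v.2) = 1.
Proof.
rewrite -sqnorm_gt0 => v0; pose r := Num.sqrt (sqnorm v).
have r0 : 0 < r by rewrite sqrtr_gt0.
exists (Complex r^-1 0).
  by rewrite eq_complex /= eqxx andbT invr_eq0 gt_eqF.
rewrite sqnormZ /= expr0n addr0 sqr_sqrtr ?sqr_ge0// exprVn sqr_sqrtr ?sqnorm_ge0//.
by rewrite mulVf// gt_eqF.
Qed.

Lemma line_of_det (S : R[i] -> R[i] -> Prop) x0 y0 : (x0 != 0) || (y0 != 0) ->
  S x0 y0 -> (forall c x y, S x y -> S (c * x) (c * y)) ->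
  (forall x y x' y', S x y -> S x' y' -> x * y' = x' * y) ->
  exists z : CP1 R, forall v, on_line z v <-> S v.1 v.2.
Proof.
move=> v0 S0 SZ Sdet; have [x00|x00] := eqVneq x0 0.
  exists None => -[x y] /=; split=> [->|Sxy].
    have y00 : y0 != 0 by move: v0; rewrite x00 eqxx.
    by have := SZ (y / y0) _ _ S0; rewrite x00 mulr0 divfK.
  have y00 : y0 != 0 by move: v0; rewrite x00 eqxx.
  have /eqP := Sdet _ _ _ _ S0 Sxy; rewrite x00 mul0r eq_sym mulf_eq0 (negPf y00) orbF.
  by move/eqP.
exists (Some (y0 / x0)) => -[x y] /=; split=> [->|Sxy].
  by have := SZ (x / x0) _ _ S0; rewrite divfK// mulrAC [x * y0]mulrC mulrAC.
apply: (mulfI x00); rewrite (Sdet _ _ _ _ S0 Sxy); field; exact: x00.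
Qed.

End normalization.

(** * Families over the compact base *)

Section families.
Variables (R : realType) (X : topologicalType).
Hypothesis cptX : compact [set: X].
Variables (al be : X -> int -> R[i]) (C M : R).
Hypotheses (C0 : 0 <= C) (co : forall x, coercive (al x) (be x) C).
Hypotheses (cal : forall n, continuous (al ^~ n)) (cbe : forall n, continuous (be ^~ n)).
Hypotheses (alM : forall x n, nm (al x n) <= M) (beM : forall x n, nm (be x n) <= M).

Let K1 := 3 * C * M ^+ 2.

(** The radius [K1] is the bound that [forward_bound] gives for a unit initial vector; the remaining
    conditions each involve finitely many entries. *)
Lemma compact_solutions : compact [set p : X * seqs R |
  [/\ sqnorm (p.2 0, p.2 (- 1)) = 1,
      forall n, 0 <= n -> jac (al p.1) (be p.1) p.2 n = 0 & l2_le p.2 K1]].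
Proof.
have ce n : continuous (fun p : X * seqs R => p.2 n : R[i]).
  exact: (continuous_snd (@eval_continuous R n)).
apply: subclosed_compact (compact_setX cptX (@compact_l2_le R K1)) _; last first.
  by move=> p [].
have -> : [set p : X * seqs R | [/\ sqnorm (p.2 0, p.2 (- 1)) = 1,
      forall n, 0 <= n -> jac (al p.1) (be p.1) p.2 n = 0 & l2_le p.2 K1]] =
  [set p | sqnorm (p.2 0, p.2 (- 1)) = 1] `&`
  ((\bigcap_(n in [set n | 0 <= n]) [set p | jac (al p.1) (be p.1) p.2 n = 0]) `&`
  [set p | l2_le p.2 K1]).
  by apply/seteqP; split=> p /=; [case|case=> ? []].
apply: closedI; last apply: closedI.
- by apply: closed_fun_eq; apply: continuous_sqnorm; exact: ce.
- apply: closed_bigI => n _; apply: closed_fun_eq0.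
  have ca m : continuous (fun p : X * seqs R => al p.1 m).
    exact: (continuous_fst (@cal m)).
  have cb m : continuous (fun p : X * seqs R => be p.1 m).
    exact: (continuous_fst (@cbe m)).
  exact: (@continuous_jac R _ (fun p : X * seqs R => al p.1)
    (fun p : X * seqs R => be p.1) (fun p : X * seqs R => p.2) n ca cb ce).
- have csnd : continuous (@snd X (seqs R)) by move=> p; exact: cvg_snd.
  exact: closed_preimage csnd (@closed_l2_le R K1).
Qed.

(** The image of [compact_solutions] under evaluation at 0 and -1. A solution witnessing stability
    may be large to the left of -1, where the equations at n >= 0 do not look, so it is first set to
    zero there. *)
Lemma compact_stable : compact [set p : X * (R[i] * R[i]) |
  stable (al p.1) (be p.1) p.2.1 p.2.2 /\ sqnorm p.2 = 1].
Proof.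
pose h (p : X * seqs R) : X * (R[i] * R[i]) := (p.1, (p.2 0, p.2 (- 1))).
have ch : continuous h.
  apply: continuous_pair; first by move=> p; exact: cvg_fst.
  by apply: continuous_pair; exact: (continuous_snd (@eval_continuous R _)).
have := continuous_compact (continuous_subspaceT ch) compact_solutions.
congr compact; apply/seteqP; split=> [_ [[x f] /= [f1 jf fK] <-]|[x [y z]] /=].
  by split => //; exists f; split=> //; exists K1.
move=> [[f [[K fK] jf f0 fm1]] f1].
pose g n := if 0 - 1 <= n then f n else 0.
exists (x, g); last by rewrite /h /= -f0 -fm1.
split=> /=; first by rewrite -f1 -f0 -fm1.
  move=> n n0; rewrite -(jf n n0) /jac /g.
  have -> : 0 - 1 <= n - 1 by lia.
  have -> : 0 - 1 <= n + 1 by lia.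
  by have -> : 0 - 1 <= n by lia.
have := forward_bound C0 (@co x) (alM x) (beM x) fK jf.
rewrite -/K1 sub0r f0 fm1 -/(sqnorm (y, z)) f1 mulr1.
apply: le_sums_le => n; rewrite /g sub0r; case: ifP => // _.
by rewrite Normc.normc0 expr0n.
Qed.

Lemma closed_stable_neq0 : hausdorff_space X ->
  closed [set x | exists y z, ((y != 0) || (z != 0)) /\ stable (al x) (be x) y z].
Proof.
move=> hX; have cfst : continuous (@fst X (R[i] * R[i])) by move=> p; exact: cvg_fst.
have := continuous_compact (continuous_subspaceT cfst) compact_stable.
move=> /(compact_closed hX); congr closed; apply/seteqP; split=> x /=.
  move=> [[x' v] /= [sv v1] <-]; exists v.1, v.2; split=> //.
  by rewrite -sqnorm_gt0 v1.
move=> [y [z [yz0 syz]]]; have [c _ c1] := @normalize R (y, z) yz0.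
exists (x, (c * y, c * z)) => //=; split => //.
by have := stable_lin c 0 syz syz; rewrite !mul0r !addr0.
Qed.

End families.

Section reflected_families.
Variables (R : realType) (X : topologicalType).
Hypothesis cptX : compact [set: X].
Variables (al be : X -> int -> R[i]) (C M : R).
Hypotheses (C0 : 0 <= C) (co : forall x, coercive (al x) (be x) C).
Hypotheses (cal : forall n, continuous (al ^~ n)) (cbe : forall n, continuous (be ^~ n)).
Hypotheses (alM : forall x n, nm (al x n) <= M) (beM : forall x n, nm (be x n) <= M).

Let al' x := reflc (al x).
Let be' x := refl (be x).
Let co' x : coercive (al' x) (be' x) C.
Proof. exact: coercive_refl. Qed.
Let cal' n : continuous (al' ^~ n).
Proof.
by move=> x; apply: (@cvg_comp _ _ _ (al ^~ (- 2 - n)) (@conjc R));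
  [exact: cal|exact: conjc_continuous].
Qed.
Let cbe' n : continuous (be' ^~ n). Proof. exact: cbe. Qed.
Let alM' x n : nm (al' x n) <= M. Proof. by rewrite /al' nm_conj alM. Qed.
Let beM' x n : nm (be' x n) <= M. Proof. exact: beM. Qed.

Lemma compact_unstable : compact [set p : X * (R[i] * R[i]) |
  unstable (al p.1) (be p.1) p.2.1 p.2.2 /\ sqnorm p.2 = 1].
Proof.
pose h (p : X * (R[i] * R[i])) : X * (R[i] * R[i]) := (p.1, (p.2.2, p.2.1)).
have c1 : continuous (fun w : R[i] * R[i] => w.1) by move=> w; exact: cvg_fst.
have c2 : continuous (fun w : R[i] * R[i] => w.2) by move=> w; exact: cvg_snd.
have ch : continuous h.
  apply: continuous_pair; first by move=> p; exact: cvg_fst.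
  by apply: continuous_pair; [exact: (continuous_snd c2)|exact: (continuous_snd c1)].
have := continuous_compact (continuous_subspaceT ch)
  (compact_stable cptX C0 co' cal' cbe' alM' beM').
congr compact; apply/seteqP; split=> [_ [[x [y z]] /= [syz yz1] <-]|[x [y z]] /=].
  by split; [exact/unstable_refl|rewrite /sqnorm /= addrC].
move=> [/unstable_refl uyz yz1]; exists (x, (z, y)) => //=; split => //.
by rewrite -yz1 /sqnorm /= addrC.
Qed.

Lemma closed_unstable_neq0 : hausdorff_space X ->
  closed [set x | exists y z, ((y != 0) || (z != 0)) /\ unstable (al x) (be x) y z].
Proof.
move=> hX; have := closed_stable_neq0 cptX C0 co' cal' cbe' alM' beM' hX.
congr closed; apply/seteqP; split=> x /= [y [z [yz0 syz]]]; exists z, y;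
  by rewrite orbC; split => //; exact/unstable_refl.
Qed.

End reflected_families.

(** * Integer iterates of a homeomorphism *)

Section homeomorphisms.
Variables (X : topologicalType) (T : homeo X).

Lemma iterzS n x : iterz T (n + 1) x = iterz T n (T x).
Proof.
case: n => [n|[|n]]; last 1 first.
- have -> : Negz n.+1 + 1 = Negz n by lia.
  change (iter n.+1 (homeo_inv T) x = iter n.+2 (homeo_inv T) (T x)).
  by rewrite [RHS]iterSr homeo_funK.
- have -> : Posz n + 1 = n.+1 by lia.
  exact: iterSr.
- by rewrite /= homeo_funK.
Qed.

Lemma iterzD m n x : iterz T (m + n) x = iterz T m (iterz T n x).
Proof.
elim/int_rec: n m x => [m x|n IH m x|n IH m x]; first by rewrite addr0.
  have -> : m + n.+1%:Z = m + n + 1 by lia.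
  have -> : n.+1%:Z = n%:Z + 1 by lia.
  by rewrite !iterzS IH.
rewrite -(homeo_invK T x) -!iterzS.
have -> : m - n.+1%:Z + 1 = m - n%:Z by lia.
have -> : - n.+1%:Z + 1 = - n%:Z by lia.
exact: IH.
Qed.

Lemma iterz_continuous n : continuous (iterz T n).
Proof.
have ci (f : X -> X) k : continuous f -> continuous (iter k f).
  by move=> cf; elim: k => [|k IH] x; [exact: cvg_id|
    apply: (@continuous_comp _ _ _ (iter k f) f); [exact: IH|exact: cf]].
by case: n => n; apply: ci; [exact: homeo_continuous|exact: homeo_inv_continuous].
Qed.

End homeomorphisms.

Lemma compact_nm_bounded (R : realType) (X : topologicalType) (f : X -> R[i]) :
  compact [set: X] -> continuous f -> exists M : R, forall x, nm (f x) <= M.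
Proof.
move=> cptX /nm_comp_continuous cf.
have /compact_bounded : compact ((@Normc.normc R \o f : X -> R) @` [set: X]).
  by apply: continuous_compact => //; exact: continuous_subspaceT.
move=> [M [_ bM]]; exists (M + 1) => x.
have := bM (M + 1) _ (nm (f x)); rewrite /= ger0_norm ?normc_ge0//.
by apply; [rewrite ltrDl|exists x].
Qed.

(** * The Jacobi coefficients along orbits, and the cocycle in coordinates *)

Section jacobi_family.
Variables (R : realType) (X : metricType R).
Hypothesis cptX : compact [set: X].
Variables (T : homeo X) (a : continuousType X R[i]) (b : continuousType X R).
Variable E : R[i].

Definition offdiag (w : X) (n : int) : R[i] := a (iterz T n w).
Definition diag (w : X) (n : int) : R[i] := ((b (iterz T n w))%:C)%C - E.

Lemma offdiag_continuous n : continuous (offdiag ^~ n).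
Proof.
move=> w; apply: (@cvg_comp _ _ _ (iterz T n) a); first exact: iterz_continuous.
exact: (@cts_fun _ _ a).
Qed.

Lemma diag_continuous n : continuous (diag ^~ n).
Proof.
move=> w; apply: cvgB; last exact: cvg_cst.
apply: (@cvg_comp _ _ _ (fun w => b (iterz T n w)) (fun x : R => (x%:C)%C : R[i])).
  apply: (@cvg_comp _ _ _ (iterz T n) b); first exact: iterz_continuous.
  exact: (@cts_fun _ _ b).
exact: real_complex_continuous.
Qed.

Lemma coefficients_bounded : exists M : R,
  (forall w n, nm (offdiag w n) <= M) /\ (forall w n, nm (diag w n) <= M).
Proof.
have [M1 aM1] := compact_nm_bounded cptX (@cts_fun _ _ a).
have [M2 bM2] := compact_nm_bounded cptX (@diag_continuous 0).
exists (`|M1| + `|M2|); split=> w n.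
  by rewrite (le_trans (aM1 _))// (le_trans (ler_norm _))// lerDl.
rewrite (le_trans (bM2 (iterz T n w)))// (le_trans (ler_norm _))// lerDr//.
Qed.

Lemma offdiag_iterz k w : offdiag (iterz T k w) = shift k (offdiag w).
Proof. by apply/funext => n; rewrite /offdiag -iterzD. Qed.

Lemma diag_iterz k w : diag (iterz T k w) = shift k (diag w).
Proof. by apply/funext => n; rewrite /diag -iterzD. Qed.

Definition coords (v : 'cV[R[i]]_2) : R[i] * R[i] := (v 0 0, v 1 0).

Lemma eucl_norm_coords v : eucl_norm v = Num.sqrt (sqnorm (coords v)).
Proof.
rewrite /eucl_norm big_ord_recl big_ord1 /sqnorm /=.
by congr (Num.sqrt (_ + nm (v _ _) ^+ 2)); exact: val_inj.
Qed.

Lemma mulmx_coords (A : 'M[R[i]]_2) v :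
  coords (A *m v) = (A 0 0 * v 0 0 + A 0 1 * v 1 0, A 1 0 * v 0 0 + A 1 1 * v 1 0).
Proof.
rewrite /coords !mxE !big_ord_recl !big_ord0 !addr0.
by have -> : lift ord0 ord0 = 1 :> 'I_2 by exact: val_inj.
Qed.

Lemma cocycle_coords w v : coords (jacobi_cocycle T a b E w *m v) =
  (- diag w 0 * (coords v).1 - conjc (offdiag w (- 1)) * (coords v).2,
   offdiag w 0 * (coords v).1).
Proof.
rewrite mulmx_coords !mxE /= mul0r addr0 /diag opprB mulNr.
by [].
Qed.

Lemma cocycle_iter_coords N w v :
  coords (cocycle_iter T (jacobi_cocycle T a b E) N w *m v) =
  transfer (offdiag w) (diag w) N (coords v).
Proof.
elim: N => [|N IH] /=; first by rewrite mul1mx.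
rewrite -mulmxA cocycle_coords IH.
have -> : iter N T w = iterz T N w by [].
rewrite offdiag_iterz diag_iterz /shift add0r.
by have -> : - 1 + N%:Z = N%:Z - 1 by lia.
Qed.

(** The stable vectors form only a line because some unstable vector is nonzero, and conversely, so
    both existence hypotheses enter the construction of each line. *)
Lemma coercive_dominated C : 0 <= C ->
  (forall w, coercive (offdiag w) (diag w) C) ->
  (forall w, exists x y, ((x != 0) || (y != 0)) /\ stable (offdiag w) (diag w) x y) ->
  (forall w, exists x y, ((x != 0) || (y != 0)) /\ unstable (offdiag w) (diag w) x y) ->
  dominated_splitting T (jacobi_cocycle T a b E).
Proof.
move=> C0 co sne une.
have [M [aM bM]] := coefficients_bounded.
have hX := @metric_hausdorff R X.
have unstable_lin al be x y (c : R[i]) : unstable al be x y ->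
    unstable al be (c * x) (c * y).
  move=> /unstable_refl u; apply/unstable_refl.
  by have := stable_lin c 0 u u; rewrite !mul0r !addr0.
have /choice[Es EsP] : forall w, exists z, forall v,
    on_line z v <-> stable (offdiag w) (diag w) v.1 v.2.
  move=> w; have [x [y [xy0 sxy]]] := sne w; have [z [t [zt0 uzt]]] := une w.
  apply: (line_of_det xy0 sxy).
    by move=> c x' y' s'; have := stable_lin c 0 s' s'; rewrite !mul0r !addr0.
  by move=> x1 y1 x2 y2 s1 s2; exact: stable_det (@co w) uzt zt0 s1 s2.
have /choice[Eu EuP] : forall w, exists z, forall v,
    on_line z v <-> unstable (offdiag w) (diag w) v.1 v.2.
  move=> w; have [x [y [xy0 sxy]]] := sne w; have [z [t [zt0 uzt]]] := une w.
  apply: (line_of_det zt0 uzt).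
    by move=> c x' y' u'; exact: unstable_lin.
  by move=> x1 y1 x2 y2 s1 s2; exact: unstable_det (@co w) sxy xy0 s1 s2.
have TE w : T w = iterz T 1 w by [].
exists Es, Eu; split.
- split; apply: (graph_continuous hX).
  + move=> w; have [x [y [xy0 sxy]]] := sne w.
    have [c _ c1] := @normalize R (x, y) xy0; exists (c * x, c * y) => //.
    by apply: (@on_lineZ R (Es w) c (x, y)); apply/EsP.
  + have := compact_stable cptX C0 co offdiag_continuous diag_continuous aM bM.
    by congr compact; apply/seteqP; split=> p /= [h1 h2]; split=> //; apply/EsP.
  + move=> w; have [x [y [xy0 sxy]]] := une w.
    have [c _ c1] := @normalize R (x, y) xy0; exists (c * x, c * y) => //.
    by apply: (@on_lineZ R (Eu w) c (x, y)); apply/EuP.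
  + have := compact_unstable cptX C0 co offdiag_continuous diag_continuous aM bM.
    by congr compact; apply/seteqP; split=> p /= [h1 h2]; split=> //; apply/EuP.
- move=> w; split=> _ [v /lineP lv <-]; apply/lineP; rewrite -/(coords _) cocycle_coords.
    apply/EsP; rewrite TE offdiag_iterz diag_iterz; apply: stable_step.
    exact/EsP.
  apply/EuP; rewrite TE offdiag_iterz diag_iterz; apply: unstable_step.
  exact/EuP.
- pose K := 2 * (3 * C * M ^+ 2) ^+ 2.
  have K0 : 0 <= K by rewrite mulr_ge0 ?sqr_ge0.
  (* From [2 * K <= N + 1] the squared norms of the images differ by a factor of at least 4; [K = 0]
     is treated apart, the smaller one being zero then. *)
  pose N := (Num.bound (2 * K)).+1.
  have KN : 2 * K <= N.+1%:R.
    have /archi_boundP/ltW/le_trans -> // : 0 <= 2 * K by rewrite mulr_ge0.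
    by rewrite ler_nat /N; lia.
  (* The norms differ by a factor 2 in the weak sense; 3 / 2 leaves room for the strict inequality,
     which also uses that the image of [u] is nonzero. *)
  exists N, (3 / 2); split => //; first by lra.
  move=> w u s /lineP lu u1 /lineP ls s1.
  have norm1 v : eucl_norm v = 1 -> sqnorm (coords v) = 1.
    by rewrite eucl_norm_coords => /(congr1 (fun x => x ^+ 2));
      rewrite sqr_sqrtr ?sqnorm_ge0// expr1n.
  move: (norm1 _ u1) (norm1 _ s1) => {}u1 {}s1.
  move/EuP: lu => uu; move/EsP: ls => ss.
  have s0 : ((coords s).1 != 0) || ((coords s).2 != 0) by rewrite -sqnorm_gt0 s1.
  have u0 : ((coords u).1 != 0) || ((coords u).2 != 0) by rewrite -sqnorm_gt0 u1.
  have := transfer_domination (@co w) C0 (aM w) (bM w) N ss uu s0 s1 u1.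
  have := (unstable_transfer (@co w) N uu u0).2.
  rewrite -surjective_pairing -sqnorm_gt0 !eucl_norm_coords !cocycle_iter_coords.
  rewrite -/K; set x := sqnorm (transfer _ _ _ (coords u)).
  set y := sqnorm (transfer _ _ _ (coords s)) => x0 yx.
  have y0 : 0 <= y by exact: sqnorm_ge0.
  have y4 : 4 * y <= x.
    have [K00|Kn0] := eqVneq K 0.
      have : N.+1%:R ^+ 2 * y <= 0 by rewrite (le_trans yx)// K00 expr0n mul0r.
      by rewrite pmulr_rle0 ?exprn_gt0//; lra.
    have Kgt0 : 0 < K by rewrite lt_neqAle eq_sym Kn0.
    have : (2 * K) ^+ 2 * y <= N.+1%:R ^+ 2 * y.
      by rewrite ler_wpM2r// ler_sqr ?nnegrE// mulr_ge0.
    have : 0 < K ^+ 2 by rewrite exprn_gt0.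
    move=> K2 h; have {}h := le_trans h yx.
    by rewrite -(ler_pM2l K2); move: h; lra.
  rewrite -ltr_sqr ?nnegrE ?mulr_ge0 ?sqrtr_ge0// exprMn !sqr_sqrtr// ?(ltW x0)//.
  lra.
Qed.

Definition jacobi_sub (w : X) (f : ell2 R) : ell2 R := jacobi T a b cptX w f - E *: f.

Lemma jacobi_subE w f n : jacobi_sub w f n = jac (offdiag w) (diag w) f n.
Proof.
have -> : jacobi_sub w f n = jacobi_seq T a b w f n - E * f n by [].
by rewrite /jacobi_seq /jac /offdiag /diag mulrBl addrA.
Qed.

Lemma ell2_normP (f : ell2 R) (K : R) : 0 <= K ->
  l2_le f (K ^+ 2) <-> ell2_norm f <= K.
Proof.
move=> K0; rewrite -[ell2_norm f <= K]ler_sqr ?nnegrE ?ell2_norm_ge0//.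
by rewrite -lee_fin -sqsumE; split=> /sqsum_leP.
Qed.

Lemma l2_le_ell2 (f : int -> R[i]) K : l2_le f K -> f \in @ell2_pred R.
Proof. by move=> /sqsum_leP fK; rewrite inE /=; apply: le_lt_trans fK (ltry _). Qed.

(** * From the resolvent set to dominated splitting *)

Section resolvent.
Variable w0 : X.
Hypothesis w0E : resolvent_set (jacobi T a b cptX w0) E.

Lemma resolvent_inverse : exists S : ell2 R -> ell2 R, exists2 C : R, 0 <= C &
  [/\ cancel (jacobi_sub w0) S, cancel S (jacobi_sub w0) &
      forall f, ell2_norm (S f) <= C * ell2_norm f].
Proof.
have [S [cS JS SJ]] : bounded_inverse (jacobi_sub w0).
  by apply: contrapT; exact: w0E.
have /linear_bounded_continuous/linear_boundedP[M [Mr SM]] := cS.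
(* [SM] applies to numbers strictly above [M], and [M] lies in [R[i]]; hence the modulus of
   [M + 1]. *)
exists S, (nm (M + 1)); first exact: normc_ge0.
split=> // f; have := SM (M + 1); rewrite ltrDl ltr01 => /(_ isT f) h.
have r1 : M + 1 <= `|M + 1|.
  by apply: real_ler_norm; rewrite realD ?real1.
rewrite -lecR rmorphM /=.
apply: le_trans h _; apply: ler_wpM2r => //; exact: normr_ge0.
Qed.

Lemma resolvent_coercive : exists2 C : R, 0 <= C & coercive (offdiag w0) (diag w0) C.
Proof.
have [S [C C0 [JS SJ SC]]] := resolvent_inverse.
exists (C ^+ 2); first exact: sqr_ge0.
move=> f K0 K fK0 jfK; have K_ge0 := sums_le_ge0 jfK.
pose F := Ell2 (l2_le_ell2 fK0).
have JK : ell2_norm (jacobi_sub w0 F) <= Num.sqrt K.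
  apply/ell2_normP; first exact: sqrtr_ge0.
  by rewrite sqr_sqrtr//; apply: le_sums_le jfK => n; rewrite jacobi_subE.
have /ell2_normP : ell2_norm F <= C * Num.sqrt K.
  by rewrite -[F]JS (le_trans (SC _))// ler_wpM2l.
by rewrite mulr_ge0 ?sqrtr_ge0// => /(_ isT); rewrite exprMn sqr_sqrtr.
Qed.

Lemma resolvent_green m : exists g K,
  l2_le g K /\ forall n, jac (offdiag w0) (diag w0) g n = (n == m)%:R.
Proof.
have [S [C C0 [JS SJ SC]]] := resolvent_inverse.
pose d := Ell2 (l2_le_ell2 (l2_le_delta R m)).
exists (S d), (ell2_norm (S d) ^+ 2); split.
  by apply/ell2_normP => //; exact: ell2_norm_ge0.
by move=> n; rewrite -jacobi_subE SJ.
Qed.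

Lemma resolvent_dominated : closure (two_sided_orbit T w0) = [set: X] ->
  dominated_splitting T (jacobi_cocycle T a b E).
Proof.
move=> dense; have [C C0 co0] := resolvent_coercive.
have [M [aM bM]] := coefficients_bounded.
have co w : coercive (offdiag w) (diag w) (4 * C).
  apply: (coercive_closure C0 offdiag_continuous diag_continuous aM bM (D := two_sided_orbit T w0)).
    move=> _ [k _ <-]; rewrite offdiag_iterz diag_iterz.
    exact: (coercive_shift (k := k) co0).
  by rewrite dense.
have C40 : 0 <= 4 * C by rewrite mulr_ge0.
have hX := @metric_hausdorff R X.
have everywhere (A : set X) : closed A -> two_sided_orbit T w0 `<=` A -> forall w, A w.
  move=> cA sA w; have : closure (two_sided_orbit T w0) w by rewrite dense.
  by move=> /(closure_subset sA); rewrite -(closure_id A).1.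
have green k m : exists g K, l2_le g K /\ forall n,
    jac (shift k (offdiag w0)) (shift k (diag w0)) g n = (n == m)%:R.
  have [g [K [gK jg]]] := resolvent_green (m + k).
  exists (shift k g), K; split; first exact: l2_shift.
  by move=> n; rewrite jac_shift jg (inj_eq (addIr k)).
apply: (coercive_dominated C40 co).
  apply: everywhere; first exact: (closed_stable_neq0 cptX C40 co
    offdiag_continuous diag_continuous aM bM hX).
  move=> _ [k _ <-]; have := green k.
  move: (co (iterz T k w0)) (aM (iterz T k w0)).
  by rewrite offdiag_iterz diag_iterz; exact: green_stable.
apply: everywhere; first exact: (closed_unstable_neq0 cptX C40 co
  offdiag_continuous diag_continuous aM bM hX).
move=> _ [k _ <-] /=.
have := coercive_refl (co (iterz T k w0)); have := aM (iterz T k w0).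
rewrite offdiag_iterz diag_iterz => aMk cok.
have [|m|y [x [yx0 syx]]] := green_stable cok (M := M).
- by move=> n; rewrite nm_conj; exact: aMk.
(* The reflection moves the pole [- 1 - m] to [m]. *)
- have [g [K [gK jg]]] := green k (- 1 - m).
  exists (refl g), K; split; first exact: (l2_le_inj (@refl_inj) gK).
  by move=> n; rewrite jac_refl jg; congr (_%:R); apply/eqP/eqP; lia.
- by exists x, y; rewrite orbC; split=> //; exact/unstable_refl.
Qed.

End resolvent.

End jacobi_family.

(** * Products over intervals and one-sided recursions *)

Lemma nm_sqr_mul_le1 (R : realType) (x y : R[i]) :
  nm y <= 1 -> nm (x * y) ^+ 2 <= nm x ^+ 2.
Proof.
move=> y1; rewrite Normc.normcM exprMn; apply: ler_piMr; rewrite ?sqr_ge0//.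
by rewrite expr_le1 ?normc_ge0.
Qed.

Lemma nm_prod (R : realType) (m : nat) (F : nat -> R[i]) :
  nm (\prod_(i < m) F i) = \prod_(i < m) nm (F i).
Proof.
elim: m => [|m IH]; first by rewrite !big_ord0 Normc.normc1.
by rewrite !big_ord_recr Normc.normcM IH.
Qed.

Lemma prod_recl (K : comPzRingType) (F : int -> K) k n : \prod_(i < k.+1) F (n + i%:Z) =
  F n * \prod_(i < k) F (n + 1 + i%:Z).
Proof.
rewrite big_ord_recl addr0; congr (_ * _); apply: eq_bigr => i _.
by rewrite lift0 intS addrA.
Qed.

Lemma prod_addr (K : comPzRingType) (F : int -> K) j k n :
  \prod_(i < j + k) F (n + i%:Z) =
  (\prod_(i < j) F (n + i%:Z)) * \prod_(i < k) F (n + j%:Z + i%:Z).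
Proof.
by rewrite big_split_ord; congr (_ * _); apply: eq_bigr => i _; rewrite -addrA.
Qed.

Lemma prod_rev (K : comPzRingType) (F : int -> K) k n :
  \prod_(i < k) F (n - i%:Z) = \prod_(i < k) F (n + 1 - k%:Z + i%:Z).
Proof.
rewrite (reindex_inj rev_ord_inj) /=; apply: eq_bigr => i _; congr F.
by have := ltn_ord i; lia.
Qed.

Section one_sided_recursions.
Variable R : realType.

Lemma exprn_small (t e : R) : 0 <= t -> t < 1 -> 0 < e -> exists n, t ^+ n <= e.
Proof.
move=> t0 t1 e0; have /cvg_expr : `|t| < 1 by rewrite ger0_norm.
move=> /cvgr_lt /(_ e e0) [n _ /(_ n (leqnn n)) /ltW tn].
by exists n.
Qed.

Lemma sqr_sum_le (k : nat) (y : nat -> R) :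
  (\sum_(i < k) y i) ^+ 2 <= k%:R * \sum_(i < k) y i ^+ 2.
Proof.
have cross j z : 2 * (\sum_(i < j) y i) * z <= \sum_(i < j) y i ^+ 2 + j%:R * z ^+ 2.
  elim: j => [|j IH]; first by rewrite !big_ord0; lra.
  rewrite !big_ord_recr -natr1 /=; have := sqr_ge0 (y j - z); lra.
elim: k => [|k IH]; first by rewrite !big_ord0 expr0n mul0r.
rewrite !big_ord_recr -natr1 /=; have := cross k (y k); lra.
Qed.

(* q-products over k consecutive indices at most 1/4: the recursion is a
   contraction of l^2 after k steps. *)
Lemma recursion_l2 (k : nat) (W : R) (q x y : int -> R) K0 K :
  1 <= W -> (forall n, 0 <= x n) -> (forall n, 0 <= y n) ->
  (forall n, 0 <= q n <= W) -> (forall n, \prod_(i < k) q (n + i%:Z) <= 1 / 4) ->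
  (forall n, x n <= q n * x (n + 1) + y n) ->
  sums_le (fun n => x n ^+ 2) K0 -> sums_le (fun n => y n ^+ 2) K ->
  sums_le (fun n => x n ^+ 2) (4 * W ^+ (2 * k) * k%:R ^+ 2 * K).
Proof.
move=> W1 x0 y0 qW qk xq xK0 yK; have W0 : 0 <= W by lra.
have q0 n : 0 <= q n by have /andP[] := qW n.
(* Each forcing term carries fewer than [j] factors [q]; as [1 <= W], the power W^j serves for all
   of them. *)
have iter j n : x n <= \prod_(i < j) q (n + i%:Z) * x (n + j%:Z) +
    W ^+ j * \sum_(i < j) y (n + i%:Z).
  elim: j n => [|j IH] n; first by rewrite !big_ord0 mul1r mulr0 !addr0.
  rewrite big_ord_recr [\sum_(i < j.+1) _]big_ord_recr /=.
  have Pq : \prod_(i < j) q (n + i%:Z) <= W ^+ j.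
    have <- : \prod_(i < j) W = W ^+ j by rewrite prodr_const card_ord.
    by apply: ler_prod => i _; exact: qW.
  have P0 : 0 <= \prod_(i < j) q (n + i%:Z) by apply: prodr_ge0 => i _; exact: q0.
  have := ler_wpM2l P0 (xq (n + j%:Z)).
  have -> : n + j%:Z + 1 = n + j.+1%:Z by lia.
  have Y0 : 0 <= \sum_(i < j) y (n + i%:Z) by apply: sumr_ge0 => i _; exact: y0.
  have Wj : W ^+ j <= W ^+ j.+1 by rewrite exprS ler_peMl ?exprn_ge0.
  have := ler_wpM2r Y0 Wj; have := ler_wpM2r (y0 (n + j%:Z)) (le_trans Pq Wj).
  have := IH n; lra.
pose v n := 2 * W ^+ (2 * k) * k%:R * \sum_(i < k) y (n + i%:Z) ^+ 2.
have vK : sums_le v (2 * W ^+ (2 * k) * k%:R * (k%:R * K)).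
  apply: sums_leZ; first by rewrite !mulr_ge0 ?exprn_ge0.
  elim: (k) => [|j IH].
    by move=> s us; rewrite big1 ?mul0r// => i _; rewrite big_ord0.
  have yj : sums_le (fun n => y (n + j%:Z) ^+ 2) K.
    by apply: (sums_le_inj (e := fun n => n + j%:Z)) yK => n m; exact: addIr.
  have -> : j.+1%:R * K = j%:R * K + K by rewrite -natr1; ring.
  by apply: le_sums_le (sums_leD IH yj) => n; rewrite big_ord_recr.
(* (A / 4 + B Y)^2 <= A^2 / 8 + 2 B^2 Y^2, and Cauchy-Schwarz for the sum [Y] of [k] terms. *)
have xv n : x n ^+ 2 <= 1 / 8 * x (n + k%:Z) ^+ 2 + v n.
  have h : x n <= 1 / 4 * x (n + k%:Z) + W ^+ k * \sum_(i < k) y (n + i%:Z).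
    by apply: le_trans (iter k n) _; rewrite lerD2r ler_wpM2r.
  have Y0 : 0 <= \sum_(i < k) y (n + i%:Z) by apply: sumr_ge0 => i _; exact: y0.
  have sq := sqr_sum_le k (fun i => y (n + i%:Z)).
  have W20 : 0 <= 2 * W ^+ (2 * k) by rewrite mulr_ge0 ?exprn_ge0.
  have vE : v n = 2 * W ^+ (2 * k) * (k%:R * \sum_(i < k) y (n + i%:Z) ^+ 2).
    by rewrite /v !mulrA.
  have := ler_wpM2l W20 sq; rewrite -vE mulnC exprM.
  set A := x (n + k%:Z) in h *; set B := W ^+ k in h *.
  set Y := \sum_(i < k) y (n + i%:Z) in h *.
  have : x n ^+ 2 <= (1 / 4 * A + B * Y) ^+ 2.
    by rewrite ler_sqr ?nnegrE// (le_trans (x0 n) h).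
  have := sqr_ge0 (1 / 4 * A - B * Y); lra.
have := sums_le_contract (e := fun n => n + k%:Z) _ _ _ xv xK0 vK.
move=> /(_ (fun n m => @addIr _ _ _ _)) h.
have {}h := h ltac:(lra) ltac:(lra).
(* The contraction by 1/8 costs a factor 8/7, and 2 * 8/7 <= 4. *)
apply: sums_leW h; rewrite ler_pdivrMr; last by lra.
have K0' := sums_le_ge0 yK.
have : 0 <= W ^+ (2 * k) * k%:R ^+ 2 * K by rewrite !mulr_ge0 ?exprn_ge0.
lra.
Qed.

(** Dropping the first [k] terms of a partial sum leaves at most half of a partial sum, so all
    partial sums are at most twice the sum of those [k] terms. *)
Lemma geometric_sum_bound (k : nat) (b : nat -> R) : (forall j, 0 <= b j) ->
  (forall j, b (j + k)%N <= 1 / 2 * b j) ->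
  exists K, forall J, \sum_(j < J) b j <= K.
Proof.
move=> b0 bk; exists (2 * \sum_(j < k) b j) => J.
have : \sum_(j < J + k) b j <= \sum_(j < k) b j + 1 / 2 * \sum_(j < J) b j.
  rewrite addnC big_split_ord /= lerD2l mulr_sumr; apply: ler_sum => j _.
  by rewrite addnC.
rewrite big_split_ord /=.
have : 0 <= \sum_(i < k) b (J + i)%N by apply: sumr_ge0.
lra.
Qed.

Lemma sums_le_nat (h : nat -> R) K : (forall j, 0 <= h j) ->
  (forall J, \sum_(j < J) h j <= K) ->
  sums_le (fun n : int => if n is Posz j then h j else 0) K.
Proof.
move=> h0 hK s us; pose J := (\max_(i <- s) `|i|%N).+1.
pose u (n : int) := if n is Posz j then (if (j < J)%N then h j else 0) else 0.
pose t := [seq Posz j | j <- iota 0 J].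
have -> : \sum_(i <- s) (if i is Posz j then h j else 0) = \sum_(i <- s) u i.
  rewrite !big_seq; apply: eq_bigr => -[j|j] // js; rewrite /u.
  by rewrite ifT// /J ltnS; apply: (@leq_bigmax_seq _ s xpredT absz (Posz j)).
have := @sums_le_support _ u t; rewrite map_inj_uniq ?iota_uniq => [H|]; last by move=> x y [].
apply: le_trans (H isT _ _ s us) _.
- by move=> [j|j] //=; case: ifP.
- move=> [j|j] //=; case: ifP => // jJ; rewrite mem_map => [|x y []//].
  by rewrite mem_iota /= add0n jJ.
- rewrite big_map; apply: le_trans (hK J).
  rewrite -(big_mkord xpredT h) /index_iota subn0 big_seq [leRHS]big_seq.
  apply: ler_sum => j; rewrite mem_iota /= add0n => jJ.
  by rewrite jJ.
Qed.

End one_sided_recursions.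

(** * Green functions from invariant sections *)

Section splitting.
Variable R : realType.
Variables (al be s1 s2 u1 u2 c d : int -> R[i]).
(* (s1, s2) and (u1, u2) are invariant sections of the cocycle, with multipliers
   c and d. An l^2 sequence g has pairs (g n, g (n - 1)) whose coordinates along
   u and s satisfy one-sided recursions with coefficients q and p; p is c / al
   written without division, so as to allow zeros of al. *)
Hypotheses
  (S1 : forall n, - be n * s1 n - conjc (al (n - 1)) * s2 n = c n * s1 (n + 1))
  (S2 : forall n, al n * s1 n = c n * s2 (n + 1))
  (U1 : forall n, - be n * u1 n - conjc (al (n - 1)) * u2 n = d n * u1 (n + 1))
  (U2 : forall n, al n * u1 n = d n * u2 (n + 1)).

Let D n := s1 n * u2 n - s2 n * u1 n.
Let q n := al n / d n.
Let p n := conjc (al (n - 1)) * D n / (d n * D (n + 1)).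

Hypotheses (d0 : forall n, d n != 0) (D0 : forall n, D n != 0).

(** The one-step matrix has determinant [al n * conjc (al (n - 1))], evaluated here on the pair of
    sections. *)
Lemma splitting_det n : c n * d n * D (n + 1) = al n * conjc (al (n - 1)) * D n.
Proof.
have -> : c n * d n * D (n + 1) =
  (c n * s1 (n + 1)) * (d n * u2 (n + 1)) - (c n * s2 (n + 1)) * (d n * u1 (n + 1)).
  by rewrite /D; ring.
by rewrite -S1 -S2 -U1 -U2 /D; ring.
Qed.

Lemma al_p n : al n * p n = c n.
Proof.
apply: (mulIf (d0 n)); apply: (mulIf (D0 (n + 1))); rewrite splitting_det /p.
by field; rewrite d0 D0.
Qed.

(** Multiplied by [al n] this is [S2]; the route through determinants also covers [al n = 0]. *)
Lemma p_s2 n : p n * s2 (n + 1) = s1 n.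
Proof.
apply: (mulIf (d0 n)); apply: (mulIf (D0 (n + 1))).
have -> : p n * s2 (n + 1) * d n * D (n + 1) = conjc (al (n - 1)) * D n * s2 (n + 1).
  by rewrite /p; field; rewrite d0 D0.
have -> : s1 n * d n * D (n + 1) = s1 n * (s1 (n + 1) * (d n * u2 (n + 1)) -
  s2 (n + 1) * (d n * u1 (n + 1))) by rewrite /D; ring.
rewrite -U1 -U2; apply/eqP; rewrite -subr_eq0 /D; apply/eqP.
transitivity (u1 n * (s2 (n + 1) * (- be n * s1 n - conjc (al (n - 1)) * s2 n)
  - s1 (n + 1) * (al n * s1 n))); first by ring.
by rewrite S1 S2; ring.
Qed.

Lemma q_u1 n : q n * u1 n = u2 (n + 1).
Proof. by rewrite /q mulrAC U2 mulrAC divff// mul1r. Qed.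

(** [beta] is the coordinate of [(g n, g (n - 1))] along [u]. The cocycle sends this pair to [al n]
    times the next pair, minus [jac al be g n] in the first entry; compare the coordinates along [u]
    and divide by [d n]. *)
Lemma splitting_unstable_coord g n :
  let beta n := (s1 n * g (n - 1) - s2 n * g n) / D n in
  beta n = q n * beta (n + 1) + s2 (n + 1) / (d n * D (n + 1)) * jac al be g n.
Proof.
rewrite /= addrK; apply: (mulfI (d0 n)); apply: (mulIf (D0 (n + 1))).
set alpha := (g n * u2 n - g (n - 1) * u1 n) / D n.
set beta := (s1 n * g (n - 1) - s2 n * g n) / D n.
have gn : g n = alpha * s1 n + beta * u1 n.
  by rewrite /alpha /beta /D; field; exact: D0.
have gn1 : g (n - 1) = alpha * s2 n + beta * u2 n.
  by rewrite /alpha /beta /D; field; exact: D0.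
have h2 : al n * g n = alpha * c n * s2 (n + 1) + beta * d n * u2 (n + 1).
  by rewrite -mulrA -S2 -mulrA -U2 gn; ring.
have h1 : - be n * g n - conjc (al (n - 1)) * g (n - 1) =
    alpha * c n * s1 (n + 1) + beta * d n * u1 (n + 1).
  by rewrite -mulrA -S1 -mulrA -U1 gn gn1; ring.
have -> : d n * (q n * ((s1 (n + 1) * g n - s2 (n + 1) * g (n + 1)) / D (n + 1)) +
    s2 (n + 1) / (d n * D (n + 1)) * jac al be g n) * D (n + 1) =
  s1 (n + 1) * (al n * g n) - s2 (n + 1) * (al n * g (n + 1)) + s2 (n + 1) * jac al be g n.
  by rewrite /q; field; rewrite d0 D0.
rewrite h2 /jac.
transitivity (s1 (n + 1) * (alpha * c n * s2 (n + 1) + beta * d n * u2 (n + 1)) -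
  s2 (n + 1) * (alpha * c n * s1 (n + 1) + beta * d n * u1 (n + 1))).
  by rewrite /D; ring.
by rewrite -h1; ring.
Qed.

(** The coordinate along [s]. Solving for it at [n + 1] would mean dividing by [al n]; the relation
    [U2], which expresses [d n * u2 (n + 1)] as [al n * u1 n], removes that factor from the forcing
    term. *)
Lemma splitting_stable_coord g n :
  let alpha n := (g n * u2 n - g (n - 1) * u1 n) / D n in
  alpha (n + 1) = p n * alpha n + u1 n / (d n * D (n + 1)) * jac al be g n.
Proof.
rewrite /= addrK; apply: (mulfI (d0 n)); apply: (mulIf (D0 (n + 1))).
have -> : d n * ((g (n + 1) * u2 (n + 1) - g n * u1 (n + 1)) / D (n + 1)) * D (n + 1) =
  g (n + 1) * (d n * u2 (n + 1)) - g n * (d n * u1 (n + 1)).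
  by field; exact: D0.
rewrite -U1 -U2.
have -> : d n * (p n * ((g n * u2 n - g (n - 1) * u1 n) / D n) +
    u1 n / (d n * D (n + 1)) * jac al be g n) * D (n + 1) =
  conjc (al (n - 1)) * (g n * u2 n - g (n - 1) * u1 n) + u1 n * jac al be g n.
  by rewrite /p; field; rewrite d0 !D0.
by rewrite /jac; ring.
Qed.

Variables (N : nat) (th dl Kd M : R).
Hypotheses (th0 : 0 <= th) (th1 : th < 1) (dl0 : 0 < dl)
  (dld : forall n, dl <= nm (d n)) (dlD : forall n, dl <= nm (D n))
  (dKd : forall n, nm (d n) <= Kd) (D2 : forall n, nm (D n) <= 2)
  (alM : forall n, nm (al n) <= M)
  (cd : forall n, \prod_(i < N) nm (c (n + i%:Z)) <=
                  th * \prod_(i < N) nm (d (n + i%:Z))).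

Let r n := nm (q n) * nm (p n).

(** By [al_p], [r] is the modulus of [c / d], so [cd] bounds its product over each block of length
    [N] by [th]. *)
Lemma splitting_ratio t n : \prod_(i < t * N) r (n + i%:Z) <= th ^+ t.
Proof.
have r0 m : 0 <= r m by rewrite mulr_ge0 ?normc_ge0.
have cE m : nm (c m) = r m * nm (d m).
  by rewrite -al_p Normc.normcM -{1}[al m](divfK (d0 m)) Normc.normcM mulrAC.
elim: t n => [|t IH] n; first by rewrite mul0n big_ord0.
rewrite mulSn big_split_ord /= exprS; apply: ler_pM.
- by apply: prodr_ge0.
- by apply: prodr_ge0.
- have P0 : 0 < \prod_(i < N) nm (d (n + i%:Z)).
    by apply: prodr_gt0 => i _; rewrite nm_gt0.
  rewrite -(ler_pM2r P0) -big_split /=; apply: le_trans (cd n).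
  by rewrite le_eqVlt; apply/orP; left; apply/eqP; apply: eq_bigr => i _; rewrite cE.
- apply: le_trans (IH (n + N%:Z)); rewrite le_eqVlt; apply/orP; left; apply/eqP.
  by apply: eq_bigr => i _; congr r; lia.
Qed.

Let A n := nm (d (n - 1)) * nm (D n).

(** [p n] and [q (n - 1)] contain [al (n - 1)] up to conjugation, so their moduli differ by the
    factor [A n / A (n + 1)], and products telescope. This is where the symmetric form of the Jacobi
    operator enters. *)
Lemma splitting_telescope m n :
  (\prod_(i < m) nm (p (n + i%:Z))) * A (n + m%:Z) =
  (\prod_(i < m) nm (q (n - 1 + i%:Z))) * A n.
Proof.
elim: m => [|m IH]; first by rewrite !big_ord0 !mul1r addr0.
have pA k : nm (p k) * A (k + 1) = nm (q (k - 1)) * A k.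
  rewrite /A /p /q addrK !Normc.normcM !Normc.normcV !Normc.normcM nm_conj.
  by field; rewrite !nm_eq0 D0 !d0.
rewrite !big_ord_recr /= -mulrA.
have -> : n + m.+1%:Z = n + m%:Z + 1 by lia.
have -> : n - 1 + m%:Z = n + m%:Z - 1 by lia.
by rewrite pA mulrCA IH; ring.
Qed.

(** A product [Q] of [t * N + 1] factors |q| contains the windows [Q1] from [n] and [Q2] from
    [n + 1], so Q^2 is Q1 Q2 times two factors at most [W]. By telescoping, [Q1] is comparable to
    the product [P] of |p| over the window of [Q2], and Q2 P <= th^t. Hence [Q] is small, and
    telescoping carries this over to [p]. *)
Lemma splitting_contraction : exists (k : nat) (W : R), [/\ 1 <= W,
  forall n, 0 <= nm (q n) <= W, forall n, 0 <= nm (p n) <= W,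
  forall n, \prod_(i < k) nm (q (n + i%:Z)) <= 1 / 4 &
  forall n, \prod_(i < k) nm (p (n + i%:Z)) <= 1 / 4].
Proof.
have M0 : 0 <= M := le_trans (normc_ge0 _) (alM 0).
have Kd0 : 0 < Kd := lt_le_trans dl0 (le_trans (dld 0) (dKd 0)).
pose a0 := dl ^+ 2; have a00 : 0 < a0 by rewrite exprn_gt0.
pose B := 2 * Kd; have B0 : 0 < B by rewrite mulr_gt0.
have Aa n : a0 <= A n by rewrite /A /a0 expr2; apply: ler_pM => //; exact: ltW.
have AB n : A n <= B.
  by rewrite /A /B mulrC; apply: ler_pM; rewrite ?normc_ge0.
have A0 n : 0 < A n := lt_le_trans a00 (Aa n).
pose W := 1 + M / dl + M * 2 / a0.
have Mdl : 0 <= M / dl by rewrite divr_ge0// ltW.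
have M2a : 0 <= M * 2 / a0 by rewrite divr_ge0 ?mulr_ge0// ltW.
have qW n : 0 <= nm (q n) <= W.
  rewrite normc_ge0 /=; apply: (@le_trans _ _ (M / dl)); last by rewrite /W; lra.
  rewrite /q Normc.normcM Normc.normcV; apply: ler_pM => //.
  - exact: normc_ge0.
  - by rewrite invr_ge0 normc_ge0.
  - by rewrite lef_pV2 ?posrE ?nm_gt0.
have pW n : 0 <= nm (p n) <= W.
  rewrite normc_ge0 /=; apply: (@le_trans _ _ (M * 2 / a0)); last by rewrite /W; lra.
  rewrite /p Normc.normcM Normc.normcV !Normc.normcM nm_conj; apply: ler_pM.
  - by rewrite mulr_ge0 ?normc_ge0.
  - by rewrite invr_ge0 mulr_ge0 ?normc_ge0.
  - by apply: ler_pM; rewrite ?normc_ge0.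
  - rewrite lef_pV2 ?posrE ?mulr_gt0 ?nm_gt0// /a0 expr2.
    by apply: ler_pM => //; exact: ltW.
have W1 : 1 <= W by rewrite /W; lra.
have W0 : 0 < W by lra.
(* 1/4 is the target for [q]; the second entry absorbs the loss B / a0 in passing to [p]. *)
pose e := Num.min (1 / 4) (a0 / (4 * B)).
have e0 : 0 < e by rewrite lt_min divr_gt0//= divr_gt0// mulr_gt0.
have [t tht] : exists t, th ^+ t <= e ^+ 2 * a0 / (W ^+ 2 * B).
  apply: exprn_small => //; apply: divr_gt0; last by rewrite mulr_gt0// exprn_gt0.
  by rewrite mulr_gt0// exprn_gt0.
have q0 n : 0 <= nm (q n) by exact: normc_ge0.
have Qe n : \prod_(i < (t * N).+1) nm (q (n + i%:Z)) <= e.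
  set Q := \prod_(i < _) _.
  have Q0 : 0 <= Q by apply: prodr_ge0.
  rewrite -ler_sqr ?nnegrE ?(ltW e0)//.
  pose Q1 := \prod_(i < t * N) nm (q (n + i%:Z)).
  pose Q2 := \prod_(i < t * N) nm (q (n + 1 + i%:Z)).
  pose P := \prod_(i < t * N) nm (p (n + 1 + i%:Z)).
  have E1 : Q = Q1 * nm (q (n + (t * N)%N%:Z)) by rewrite /Q big_ord_recr.
  have E2 : Q = nm (q n) * Q2.
    exact: (prod_recl (fun n => nm (q n))).
  have tel : P * A (n + 1 + (t * N)%N%:Z) = Q1 * A (n + 1).
    by rewrite splitting_telescope addrK.
  have QP : Q2 * P <= th ^+ t.
    apply: le_trans (splitting_ratio t (n + 1)).
    by rewrite /Q2 /P -big_split.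
  have P0 : 0 <= P by apply: prodr_ge0 => i _; exact: normc_ge0.
  have Q10 : 0 <= Q1 by apply: prodr_ge0.
  have Q20 : 0 <= Q2 by apply: prodr_ge0.
  have Q1P : a0 * Q1 <= B * P.
    have h1 := ler_wpM2l Q10 (Aa (n + 1)).
    have h2 := ler_wpM2l P0 (AB (n + 1 + (t * N)%N%:Z)).
    by move: h1 h2; rewrite -tel; lra.
  have Q12 : a0 * (Q1 * Q2) <= B * th ^+ t.
    have := ler_wpM2r Q20 Q1P; have := ler_wpM2l (ltW B0) QP; lra.
  have Q2W : Q ^+ 2 <= W ^+ 2 * (Q1 * Q2).
    rewrite expr2 {1}E1 E2.
    have -> : Q1 * nm (q (n + (t * N)%N%:Z)) * (nm (q n) * Q2) =
      (nm (q (n + (t * N)%N%:Z)) * nm (q n)) * (Q1 * Q2) by ring.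
    rewrite ler_wpM2r ?mulr_ge0// expr2.
    by apply: ler_pM; rewrite ?normc_ge0//;
      [have /andP[] := qW (n + (t * N)%N%:Z)|have /andP[] := qW n].
  apply: le_trans Q2W _; move: tht; rewrite ler_pdivlMr ?mulr_gt0 ?exprn_gt0// => h.
  rewrite -(ler_pM2l a00).
  have W20 : 0 <= W ^+ 2 by rewrite exprn_ge0// ltW.
  have := ler_wpM2l W20 Q12; lra.
exists (t * N).+1, W; split=> // n.
  by apply: le_trans (Qe n) _; rewrite ge_min lexx.
set P := \prod_(i < _) _.
have P0 : 0 <= P by apply: prodr_ge0 => i _; exact: normc_ge0.
have tel := splitting_telescope (t * N).+1 n.
have h1 := ler_wpM2l P0 (Aa (n + (t * N).+1%:Z)).
have h2 := ler_pM _ _ (Qe (n - 1)) (AB n).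
have Q0 : 0 <= \prod_(i < (t * N).+1) nm (q (n - 1 + i%:Z)) by apply: prodr_ge0.
have {}h2 := h2 Q0 (ltW (A0 n)).
have eB : e * B <= a0 / 4.
  have : e <= a0 / (4 * B) by rewrite ge_min lexx orbT.
  rewrite ler_pdivlMr ?mulr_gt0//; lra.
rewrite -(ler_pM2r a00); move: h1 h2; rewrite tel; lra.
Qed.

Hypotheses (s1n : forall n, nm (s1 n) <= 1) (s2n : forall n, nm (s2 n) <= 1)
  (u1n : forall n, nm (u1 n) <= 1) (u2n : forall n, nm (u2 n) <= 1).

Let nm_dD n : nm (d n * D (n + 1)) ^- 1 <= dl ^- 2.
Proof.
rewrite expr1 lef_pV2 ?posrE ?exprn_gt0 ?nm_gt0 ?mulf_neq0//.
by rewrite Normc.normcM expr2; apply: ler_pM => //; exact: ltW.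
Qed.

(** Both coordinates obey contracting recursions; [alpha] runs forward and is reversed by n -> -n to
    fit [recursion_l2]. The bound [K0] only supplies the summability which that lemma
    presupposes. *)
Lemma splitting_coercive : exists2 C : R, 0 <= C & coercive al be C.
Proof.
have [k [W [W1 qW pW qk pk]]] := splitting_contraction.
have dl4 : 0 < dl ^+ 4 by rewrite exprn_gt0.
pose L := 4 * W ^+ (2 * k) * k%:R ^+ 2 / dl ^+ 4.
have L0 : 0 <= L.
  by rewrite divr_ge0 ?(ltW dl4)// !mulr_ge0 ?exprn_ge0//; lra.
exists (4 * L); first by rewrite mulr_ge0.
move=> g K0 K gK0 gK.
pose beta n := (s1 n * g (n - 1) - s2 n * g n) / D n.
pose alpha n := (g n * u2 n - g (n - 1) * u1 n) / D n.
pose y n := nm (jac al be g n) / dl ^+ 2.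
have y0 n : 0 <= y n by rewrite divr_ge0 ?normc_ge0// exprn_ge0// ltW.
have yK : sums_le (fun n => y n ^+ 2) (K / dl ^+ 4).
  rewrite mulrC; apply: le_sums_le (sums_leZ _ gK); last by rewrite invr_ge0 ltW.
  by move=> n; rewrite /y expr_div_n -exprM mulrC.
have forcing x n : nm x <= 1 -> nm (x / (d n * D (n + 1)) * jac al be g n) <= y n.
  move=> x1; rewrite Normc.normcM /y mulrC; apply: ler_wpM2l; first exact: normc_ge0.
  rewrite Normc.normcM -[leRHS]mul1r; apply: ler_pM => //; rewrite ?normc_ge0//.
  by rewrite Normc.normcV; exact: nm_dD.
have coord (x1 x2 x3 x4 : R[i]) n : nm x1 <= 1 -> nm x3 <= 1 ->
    nm ((x1 * x2 - x3 * x4) / D n) ^+ 2 <= 2 / dl ^+ 2 * (nm x2 ^+ 2 + nm x4 ^+ 2).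
  move=> x11 x31; rewrite Normc.normcM exprMn Normc.normcV exprVn.
  have i2 : 0 <= dl ^- 2 by rewrite invr_ge0 exprn_ge0// ltW.
  have h1 : nm (x1 * x2 - x3 * x4) ^+ 2 <= 2 * nm x2 ^+ 2 + 2 * nm x4 ^+ 2.
    apply: le_trans (nm_sqrD _ _) _; rewrite nmN !Normc.normcM !exprMn.
    by apply: lerD; apply: ler_wpM2l => //; apply: ler_piMl; rewrite ?sqr_ge0//;
      rewrite expr_le1 ?normc_ge0.
  have h2 : nm (D n) ^- 2 <= dl ^- 2.
    by rewrite lef_pV2 ?posrE ?exprn_gt0 ?nm_gt0// ler_sqr ?nnegrE ?normc_ge0 ?(ltW dl0).
  have h3 := ler_pM (sqr_ge0 _) _ h1 h2.
  apply: le_trans (h3 _) _; first by rewrite invr_ge0 sqr_ge0.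
  by rewrite le_eqVlt; apply/orP; left; apply/eqP; ring.
have gm : sums_le (fun n => nm (g (n - 1)) ^+ 2) K0.
  by apply: (@l2_le_inj _ g K0 (fun n => n - 1)) gK0 => n m; exact: addIr.
have c20 : 0 <= 2 / dl ^+ 2 by rewrite divr_ge0// exprn_ge0// ltW.
have bK : l2_le beta (L * K).
  have := @recursion_l2 _ k W (fun n => nm (q n)) (fun n => nm (beta n)) y _ _ W1
    (fun n => normc_ge0 _) y0 qW qk _
    (le_sums_le _ (sums_leZ c20 (sums_leD gm gK0))) yK.
  have -> : 4 * W ^+ (2 * k) * k%:R ^+ 2 * (K / dl ^+ 4) = L * K by rewrite /L; ring.
  apply => n; last exact: coord.
  have -> : beta n = q n * beta (n + 1) + s2 (n + 1) / (d n * D (n + 1)) * jac al be g n.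
    exact: splitting_unstable_coord.
  apply: le_trans (nmD _ _) _; rewrite Normc.normcM lerD2l; exact: forcing.
have aK : l2_le alpha (L * K).
  have inj : injective (fun n : int => - n) by exact: oppr_inj.
  have inj1 : injective (fun n : int => - n - 1) by move=> n m; lia.
  have ga : l2_le alpha (2 / dl ^+ 2 * (K0 + K0)).
    apply: le_sums_le (sums_leZ c20 (sums_leD gK0 gm)) => n.
    by rewrite /alpha [g n * _]mulrC [g (n - 1) * _]mulrC; exact: coord.
  have := @recursion_l2 _ k W (fun n => nm (p (- n - 1))) (fun n => nm (alpha (- n)))
    (fun n => y (- n - 1)) _ _ W1
    (fun n => normc_ge0 _) (fun n => y0 _) (fun n => pW _) _ _
    (sums_le_inj inj ga) (sums_le_inj inj1 yK).
  have -> : 4 * W ^+ (2 * k) * k%:R ^+ 2 * (K / dl ^+ 4) = L * K by rewrite /L; ring.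
  move=> h; have {}h : l2_le (fun n => alpha (- n)) (L * K).
    apply: h => n.
      have := prod_rev (fun n => nm (p n)) k (- n - 1).
      rewrite (eq_bigr (fun i : 'I_k => nm (p (- (n + i%:Z) - 1)))) => [->|i _].
        exact: pk.
      by congr (nm (p _)); lia.
    have -> : alpha (- n) = p (- n - 1) * alpha (- n - 1) +
        u1 (- n - 1) / (d (- n - 1) * D (- n - 1 + 1)) * jac al be g (- n - 1).
      by have := splitting_stable_coord g (- n - 1); rewrite /= subrK.
    have -> : - (n + 1) = - n - 1 by lia.
    apply: le_trans (nmD _ _) _; rewrite Normc.normcM lerD2l; exact: forcing.
  have := l2_le_inj inj h; congr l2_le; apply/funext => n.
  by rewrite opprK.
have gE n : g n = alpha n * s1 n + beta n * u1 n.
  by rewrite /alpha /beta /D; field; exact: D0.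
have -> : 4 * L * K = 2 * (L * K) + 2 * (L * K) by ring.
apply: le_sums_le (sums_leD (sums_leZ _ aK) (sums_leZ _ bK)) => // n.
rewrite gE; apply: le_trans (nm_sqrD _ _) _.
by apply: lerD; apply: ler_wpM2l => //; exact: nm_sqr_mul_le1.
Qed.

(* The column of the Green function with pole 0 follows the unstable direction
   to the left of 0 and the stable one to its right. *)
Lemma splitting_green0 : exists g K,
  l2_le g K /\ forall n, jac al be g n = (n == 0)%:R.
Proof.
have [k [W [W1 qW pW qk pk]]] := splitting_contraction.
have dD0 : d 0 * D 1 != 0 by rewrite mulf_neq0// D0.
(* [bt j] is the unstable coordinate at [- j], [at_ j] the stable one at [1 + j]. Their initial
   values are the forcing terms of the two recursions at site 0, for unit right-hand side and
   vanishing coordinates [beta 1] and [alpha 0]. *)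
pose bt (j : nat) := s2 1 / (d 0 * D 1) * \prod_(i < j) q (- 1 - i%:Z).
pose at_ (j : nat) := u1 0 / (d 0 * D 1) * \prod_(i < j) p (1 + i%:Z).
have btS j : bt j.+1 = q (- 1 - j%:Z) * bt j.
  by rewrite /bt big_ord_recr /= mulrA mulrC.
have atS j : at_ j.+1 = p (1 + j%:Z) * at_ j.
  by rewrite /at_ big_ord_recr /= mulrA mulrC.
have half (x y : R) : 0 <= y -> 0 <= x -> x <= 1 / 4 -> (y * x) ^+ 2 <= 1 / 2 * y ^+ 2.
  move=> y0 x0 x4; rewrite exprMn mulrC ler_wpM2r ?sqr_ge0//.
  have : x ^+ 2 <= (1 / 4) ^+ 2 by rewrite ler_sqr ?nnegrE//; lra.
  lra.
have btk j : nm (bt (j + k)%N) ^+ 2 <= 1 / 2 * nm (bt j) ^+ 2.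
  have -> : bt (j + k)%N = bt j * \prod_(i < k) q (- 1 - j%:Z - i%:Z).
    rewrite /bt big_split_ord /= mulrA; congr (_ * _); apply: eq_bigr => i _.
    by congr q; lia.
  rewrite Normc.normcM (@nm_prod _ k (fun i => q (- 1 - j%:Z - i%:Z))).
  apply: half; rewrite ?normc_ge0//; first by apply: prodr_ge0 => i _; exact: normc_ge0.
  by rewrite (prod_rev (fun n => nm (q n))).
have atk j : nm (at_ (j + k)%N) ^+ 2 <= 1 / 2 * nm (at_ j) ^+ 2.
  have -> : at_ (j + k)%N = at_ j * \prod_(i < k) p (1 + j%:Z + i%:Z).
    by rewrite /at_ (prod_addr p) mulrA.
  rewrite Normc.normcM (@nm_prod _ k (fun i => p (1 + j%:Z + i%:Z))).
  apply: half; rewrite ?normc_ge0//; first by apply: prodr_ge0 => i _; exact: normc_ge0.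
have [Kb hKb] := geometric_sum_bound (fun j => sqr_ge0 (nm (bt j))) btk.
have [Ka hKa] := geometric_sum_bound (fun j => sqr_ge0 (nm (at_ j))) atk.
pose g (n : int) := if n <= 0 then bt `|n|%N * u1 n else at_ `|n|.-1%N * s1 n.
exists g, (Kb + Ka); split.
  have hb := sums_le_nat (fun j => sqr_ge0 (nm (bt j))) hKb.
  have ha := sums_le_nat (fun j => sqr_ge0 (nm (at_ j))) hKa.
  have ib : injective (fun n : int => - n) by exact: oppr_inj.
  have ia : injective (fun n : int => n - 1) by move=> n m; exact: addIr.
  apply: le_sums_le (sums_leD (sums_le_inj ib hb) (sums_le_inj ia ha)) => n.
  rewrite /g; case: ifPn => n0.
    have -> : - n = Posz `|n|%N by lia.
    apply: le_trans (nm_sqr_mul_le1 _ (u1n n)) _; rewrite lerDl.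
    by case: (n - 1) => // j; exact: sqr_ge0.
  have -> : n - 1 = Posz `|n|.-1%N by lia.
  apply: le_trans (nm_sqr_mul_le1 _ (s1n n)) _; rewrite lerDr.
  by case: (- n) => // j; exact: sqr_ge0.
have gneg (j : nat) : g (- j%:Z) = bt j * u1 (- j%:Z).
  by rewrite /g oppr_le0 le0z_nat abszN.
have gpos (j : nat) : g (1 + j%:Z) = at_ j * s1 (1 + j%:Z).
  by [].
have gneg1 (j : nat) : g (- j%:Z - 1) = bt j * u2 (- j%:Z).
  have -> : - j%:Z - 1 = - j.+1%:Z by lia.
  rewrite gneg btS -[RHS]mulrC; have := q_u1 (- 1 - j%:Z).
  have -> : - 1 - j%:Z + 1 = - j%:Z by lia.
  move=> <-; have -> : - j.+1%:Z = - 1 - j%:Z by lia.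
  by ring.
(* The two branches prescribe the same value at site 0. *)
have b0a0 : bt 0%N * u1 0 = at_ 0%N * s2 1.
  by rewrite /bt /at_ !big_ord0; ring.
have gpos1 (j : nat) : g (1 + j%:Z - 1) = at_ j * s2 (1 + j%:Z).
  case: j => [|j].
    by rewrite addr0 subrr -[RHS]b0a0; exact: (gneg 0%N).
  have -> : 1 + j.+1%:Z - 1 = 1 + j%:Z by lia.
  have -> : 1 + j.+1%:Z = 1 + j%:Z + 1 by lia.
  by rewrite gpos atS -(p_s2 (1 + j%:Z)); ring.
move=> n; have [n0|n0] := ltrP 0 n.
  have [j ->] : exists j : nat, n = 1 + j%:Z by exists `|n|.-1%N; lia.
  rewrite /jac gpos gpos1.
  have -> : 1 + j%:Z + 1 = 1 + j.+1%:Z by lia.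
  rewrite gpos atS.
  have -> : (1 + j%:Z == 0) = false by lia.
  have -> : 1 + j.+1%:Z = 1 + j%:Z + 1 by lia.
  transitivity (at_ j * ((al (1 + j%:Z) * p (1 + j%:Z)) * s1 (1 + j%:Z + 1) -
    (- be (1 + j%:Z) * s1 (1 + j%:Z) - conjc (al (1 + j%:Z - 1)) * s2 (1 + j%:Z)))).
    by ring.
  by rewrite al_p S1 subrr mulr0.
have [j ->] : exists j : nat, n = - j%:Z by exists `|n|%N; lia.
rewrite /jac gneg gneg1; case: j => [|j].
  rewrite oppr0 eqxx add0r; have := gpos 0%N; rewrite addr0 => ->.
  transitivity (at_ 0%N * (al 0 * s1 1) - bt 0%N * (- be 0 * u1 0 - conjc (al (0 - 1)) * u2 0)).
    by ring.
  rewrite U1 add0r /at_ /bt !big_ord0 !mulr1.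
  have -> : u1 0 / (d 0 * D 1) * (al 0 * s1 1) = (al 0 * u1 0) * s1 1 / (d 0 * D 1).
    by ring.
  rewrite U2 add0r.
  have -> : d 0 * u2 1 * s1 1 / (d 0 * D 1) - s2 1 / (d 0 * D 1) * (d 0 * u1 1) =
    d 0 * D 1 / (d 0 * D 1) by rewrite /D; ring.
  by rewrite divff.
have -> : (- j.+1%:Z == 0) = false by lia.
have -> : - j.+1%:Z + 1 = - j%:Z by lia.
rewrite gneg.
have -> : al (- j.+1%:Z) * (bt j * u1 (- j%:Z)) = bt j.+1 * (d (- j.+1%:Z) * u1 (- j%:Z)).
  rewrite btS /q; have -> : - 1 - j%:Z = - j.+1%:Z by lia.
  by field; exact: d0.
have := U1 (- j.+1%:Z); have -> : - j.+1%:Z + 1 = - j%:Z by lia.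
move=> <-; transitivity (0 : R[i]); last by [].
by ring.
Qed.


End splitting.

(** * Solving the equation for a general right-hand side *)

Section surjectivity.
Variable R : realType.
Variables (al be : int -> R[i]) (C : R).
Hypothesis co : coercive al be C.
Hypothesis green : forall m, exists g K,
  l2_le g K /\ forall n, jac al be g n = (n == m)%:R.

Lemma jac_surjective_finite f s : uniq s -> exists g K,
  l2_le g K /\ forall n, jac al be g n = if n \in s then f n else 0.
Proof.
elim: s => [_|m s IH /= /andP[ms us]].
  exists (fun=> 0), 0; split; first by move=> s _; rewrite big1// => i _;
    rewrite Normc.normc0 expr0n.
  by move=> n; rewrite /jac !mulr0 !addr0.
have [g [K [gK jg]]] := IH us; have [h [L [hL jh]]] := green m.
exists (fun n => f m * h n + g n); eexists; split; first exact: l2_leD (l2_leZ _ hL) gK.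
move=> n; rewrite jacD jacZ jh jg inE; have [->|nm_] := eqVneq n m.
  by rewrite (negPf ms) mulr1 addr0.
by rewrite mulr0 add0r.
Qed.

(* A solution is a cluster point, for pointwise convergence, of solutions with
   truncated right-hand sides. *)
Lemma jac_surjective f K : l2_le f K ->
  exists2 g, l2_le g (C * K) & forall n, jac al be g n = f n.
Proof.
move=> fK.
have /choice[G GP] : forall M : nat, exists g : seqs R,
    l2_le g (C * K) /\ forall n : int, (`|n| <= M)%N -> jac al be g n = f n.
  move=> M; pose s : seq int := [seq i%:Z - M%:Z | i <- iota 0 (M + M).+1].
  have us : uniq s by rewrite map_inj_uniq ?iota_uniq// => x y; lia.
  have [g [L [gL jg]]] := jac_surjective_finite f us.
  exists g; split=> [|n nM].
    apply: (co gL); apply: le_sums_le fK => n; rewrite jg.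
    by case: ifP => // _; rewrite Normc.normc0 expr0n sqr_ge0.
  rewrite jg ifT//; apply/mapP; exists `|(n + M%:Z)%R|%N; last by lia.
  by rewrite mem_iota; lia.
have /(_ (G @ \oo) _) [] := @compact_l2_le R (C * K).
  by exists 0%N => // M _; have [] := GP M.
move=> g [gK clg]; exists g => // n.
have cl_n : closed [set h : seqs R | jac al be h n - f n = 0].
  have cst (x : R[i]) : continuous (fun _ : seqs R => x) by exact: cst_continuous.
  have cj : continuous (fun h : seqs R => jac al be h n).
    exact: (@continuous_jac R _ (fun=> al) (fun=> be) (fun h : seqs R => h) n
      (fun m => cst _) (fun m => cst _) (@eval_continuous R)).
  by apply: closed_fun_eq0 => h; exact: (cvgB (cj h) (cst (f n) h)).
apply/eqP; rewrite -subr_eq0; apply/eqP; apply: (cl_n g).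
move: clg; rewrite clusterE => /(_ [set h : seqs R | jac al be h n - f n = 0]); apply.
exists `|n|%N => // M /= nM; have [_ h] := GP M.
by rewrite h ?subrr.
Qed.

End surjectivity.

(** * Uniform lower bounds and unit vectors on projective lines *)

Lemma compact_pos_lower_bound (R : realType) (X : topologicalType) (K : set X)
    (f : X -> R) : compact K -> continuous f -> (forall x, K x -> 0 < f x) ->
  exists2 e : R, 0 < e & forall x, K x -> e <= f x.
Proof.
move=> cK cf f0; have [->|/set0P K0] := eqVneq K set0; first by exists 1.
have [y yK fy] := compact_EVT_min K0 cK (continuous_subspaceT cf).
exists (f y); first by apply: f0; rewrite inE in yK.
by move=> x Kx; apply: fy; rewrite inE.
Qed.

Section projective_vectors.
Variable R : realType.

Lemma on_line_unit (z : CP1 R) : exists2 v, on_line z v & sqnorm v = 1.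
Proof.
have [v [zv v0]] : exists v : R[i] * R[i], on_line z v /\ (v.1 != 0) || (v.2 != 0).
  case: z => [z|]; [exists (1, z)|exists (0, 1)]; split=> //=.
  - by rewrite mulr1.
  - by rewrite oner_eq0.
  - by rewrite oner_eq0 orbT.
have [c _ c1] := normalize v0; exists (c * v.1, c * v.2) => //; exact: on_lineZ.
Qed.

Lemma collinear (v w : R[i] * R[i]) : sqnorm w = 1 -> v.1 * w.2 = w.1 * v.2 ->
  exists c : R[i], v = (c * w.1, c * w.2).
Proof.
move=> w1 vw; have : (w.1 != 0) || (w.2 != 0) by rewrite -sqnorm_gt0 w1.
case: v vw => v1 v2 /= vw; have [w10|w10] := eqVneq w.1 0.
  rewrite /= => w20; exists (v2 / w.2); rewrite divfK// w10 mulr0.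
  congr pair; apply/eqP; move/eqP: vw.
  by rewrite w10 mul0r mulf_eq0 (negPf w20) orbF.
move=> _; exists (v1 / w.1); rewrite divfK//; congr pair.
by rewrite mulrAC vw mulrAC divff// mul1r.
Qed.

Lemma on_line_collinear (z : CP1 R) v w : on_line z v -> on_line z w ->
  v.1 * w.2 = w.1 * v.2.
Proof. by case: z => [z|] /= -> ->; ring. Qed.

Lemma sqnorm1_le (v : R[i] * R[i]) : sqnorm v = 1 -> nm v.1 <= 1 /\ nm v.2 <= 1.
Proof.
rewrite /sqnorm => v1; have := sqr_ge0 (nm v.1); have := sqr_ge0 (nm v.2).
by split; rewrite -(@expr_le1 _ 2) ?normc_ge0//; lra.
Qed.

Lemma closed_unit_sphere : closed [set v : R[i] * R[i] | sqnorm v = 1].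
Proof.
by apply/closed_fun_eq/continuous_sqnorm => v; [exact: cvg_fst|exact: cvg_snd].
Qed.

Lemma compact_unit_sphere : compact [set v : R[i] * R[i] | sqnorm v = 1].
Proof.
apply: subclosed_compact closed_unit_sphere
  (compact_setX (@compact_disk R 1) (@compact_disk R 1)) _.
by move=> v /sqnorm1_le [].
Qed.

Lemma transfer_eq0 (al be : int -> R[i]) v N : transfer al be 1 v = (0, 0) ->
  transfer al be N.+1 v = (0, 0).
Proof.
move=> v0; elim: N => [//|N IH].
have -> : transfer al be N.+2 v = (- be N.+1 * (transfer al be N.+1 v).1 -
  conjc (al (N.+1%:Z - 1)) * (transfer al be N.+1 v).2,
  al N.+1 * (transfer al be N.+1 v).1) by [].
by rewrite IH !mulr0 subr0.
Qed.

End projective_vectors.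

(** * From dominated splitting to the resolvent set *)

Section dominated_resolvent.
Variables (R : realType) (X : metricType R).
Hypothesis cptX : compact [set: X].
Variables (T : homeo X) (a : continuousType X R[i]) (b : continuousType X R).
Variable E : R[i].

Local Notation offdiag := (offdiag T a).
Local Notation diag := (diag T b E).

Hypothesis ds : dominated_splitting T (jacobi_cocycle T a b E).

Lemma transfer1 w v : transfer (offdiag w) (diag w) 1 v =
  (- diag w 0 * v.1 - conjc (offdiag w (- 1)) * v.2, offdiag w 0 * v.1).
Proof. by []. Qed.

(** The unit sections are chosen pointwise and need not be continuous. Uniformity of [dl] comes from
    minimizing over the compact set [K] of all admissible triples of a base point and two unit
    vectors. *)
Lemma dominated_data : exists (s u : X -> R[i] * R[i]) (c d : X -> R[i])
    (N : nat) (th dl : R),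
  [/\ 0 <= th /\ th < 1, 0 < dl,
      forall w, sqnorm (s w) = 1 /\ sqnorm (u w) = 1,
      forall w, transfer (offdiag w) (diag w) 1 (s w) =
          (c w * (s (T w)).1, c w * (s (T w)).2) /\
        transfer (offdiag w) (diag w) 1 (u w) =
          (d w * (u (T w)).1, d w * (u (T w)).2) &
      forall w, [/\ dl <= nm (d w),
        dl <= nm ((s w).1 * (u w).2 - (s w).2 * (u w).1) &
        \prod_(i < N) nm (c (iterz T i w)) <=
          th * \prod_(i < N) nm (d (iterz T i w))]].
Proof.
have [Es [Eu [[cEs cEu] inv [N [lam [N0 lam1 dom]]]]]] := ds.
pose vec (v : R[i] * R[i]) : 'cV[R[i]]_2 := \col_(i < 2) if i == 0 then v.1 else v.2.
have coordsK v : coords (vec v) = v by case: v => x y; rewrite /coords !mxE.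
have domP w (u s : R[i] * R[i]) : on_line (Eu w) u -> sqnorm u = 1 ->
    on_line (Es w) s -> sqnorm s = 1 ->
    lam * Num.sqrt (sqnorm (transfer (offdiag w) (diag w) N s)) <
    Num.sqrt (sqnorm (transfer (offdiag w) (diag w) N u)).
  move=> lu u1 ls s1; have := dom w (vec u) (vec s).
  rewrite !eucl_norm_coords !cocycle_iter_coords !coordsK u1 s1 sqrtr1; apply=> //.
    by apply/lineP; rewrite -/(coords _) coordsK.
  by apply/lineP; rewrite -/(coords _) coordsK.
have invs w v : on_line (Es w) v -> on_line (Es (T w)) (transfer (offdiag w) (diag w) 1 v).
  move=> lv; have [+ _] := inv w => /(_ (jacobi_cocycle T a b E w *m vec v)).
  rewrite transfer1 => h; have /lineP : line (Es (T w)) (jacobi_cocycle T a b E w *m vec v).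
    by apply: h; exists (vec v) => //; apply/lineP; rewrite -/(coords _) coordsK.
  by rewrite -/(coords _) cocycle_coords coordsK.
have invu w v : on_line (Eu w) v -> on_line (Eu (T w)) (transfer (offdiag w) (diag w) 1 v).
  move=> lv; have [_ +] := inv w => /(_ (jacobi_cocycle T a b E w *m vec v)).
  rewrite transfer1 => h; have /lineP : line (Eu (T w)) (jacobi_cocycle T a b E w *m vec v).
    by apply: h; exists (vec v) => //; apply/lineP; rewrite -/(coords _) coordsK.
  by rewrite -/(coords _) cocycle_coords coordsK.
have /choice[s sP] : forall w, exists v, on_line (Es w) v /\ sqnorm v = 1.
  by move=> w; have [v] := on_line_unit (Es w); exists v.
have /choice[u uP] : forall w, exists v, on_line (Eu w) v /\ sqnorm v = 1.
  by move=> w; have [v] := on_line_unit (Eu w); exists v.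
have /choice[c cP] : forall w, exists c, transfer (offdiag w) (diag w) 1 (s w) =
    (c * (s (T w)).1, c * (s (T w)).2).
  move=> w; have [ls s1] := sP w; have [lT sT1] := sP (T w).
  exact: collinear sT1 (on_line_collinear (invs w _ ls) lT).
have /choice[d dP] : forall w, exists d, transfer (offdiag w) (diag w) 1 (u w) =
    (d * (u (T w)).1, d * (u (T w)).2).
  move=> w; have [lu u1] := uP w; have [lT uT1] := uP (T w).
  exact: collinear uT1 (on_line_collinear (invu w _ lu) lT).
pose K := [set p : X * ((R[i] * R[i]) * (R[i] * R[i])) |
  (on_line (Es p.1) p.2.1 /\ on_line (Eu p.1) p.2.2) /\
  (sqnorm p.2.1 = 1 /\ sqnorm p.2.2 = 1)].
have c11 : continuous (fun v : R[i] * R[i] => v.1) by move=> v; exact: cvg_fst.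
have c12 : continuous (fun v : R[i] * R[i] => v.2) by move=> v; exact: cvg_snd.
have cK1 : continuous (fun p : X * ((R[i] * R[i]) * (R[i] * R[i])) => p.1).
  by move=> p; exact: cvg_fst.
have cs : continuous (fun p : X * ((R[i] * R[i]) * (R[i] * R[i])) => p.2.1).
  by apply: continuous_snd => v; exact: cvg_fst.
have cu : continuous (fun p : X * ((R[i] * R[i]) * (R[i] * R[i])) => p.2.2).
  by apply: continuous_snd => v; exact: cvg_snd.
have cK : compact K.
  apply: subclosed_compact (compact_setX cptX
    (compact_setX (@compact_unit_sphere R) (@compact_unit_sphere R))) _; last first.
    by move=> p [_ []].
  apply: closedI; apply: closedI.
  - exact: closed_preimage (continuous_pair cK1 cs) (closed_on_line cEs).
  - exact: closed_preimage (continuous_pair cK1 cu) (closed_on_line cEu).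
  - exact: closed_preimage cs (@closed_unit_sphere R).
  - exact: closed_preimage cu (@closed_unit_sphere R).
have cs1 := fun p => continuous_comp (cs p) (c11 _).
have cs2 := fun p => continuous_comp (cs p) (c12 _).
have cu1 := fun p => continuous_comp (cu p) (c11 _).
have cu2 := fun p => continuous_comp (cu p) (c12 _).
pose det (p : X * ((R[i] * R[i]) * (R[i] * R[i]))) := p.2.1.1 * p.2.2.2 - p.2.1.2 * p.2.2.1.
have cdet : continuous det.
  move=> p; exact: (cvgB (cvgM (cs1 p) (cu2 p)) (cvgM (cs2 p) (cu1 p))).
pose Bu (p : X * ((R[i] * R[i]) * (R[i] * R[i]))) :=
  transfer (offdiag p.1) (diag p.1) 1 p.2.2.
have cBu : continuous (fun p => sqnorm (Bu p)).
  have coff n := continuous_fst (Z := ((R[i] * R[i]) * (R[i] * R[i]))%type)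
    (@offdiag_continuous R X T a n).
  have cdiag := continuous_fst (Z := ((R[i] * R[i]) * (R[i] * R[i]))%type)
    (@diag_continuous R X T b E 0).
  have coffc := fun p => continuous_comp (coff (- 1) p) (@conjc_continuous R _).
  apply: continuous_sqnorm => p.
    exact: (cvgB (cvgM (cvgN (cdiag p)) (cu1 p)) (cvgM (coffc p) (cu2 p))).
  exact: (cvgM (coff 0 p) (cu1 p)).
have lam0 : 0 < lam by lra.
have [dl1 dl10 dl1P] : exists2 e : R, 0 < e & forall p, K p -> e <= nm (det p).
  apply: compact_pos_lower_bound cK (nm_comp_continuous cdet) _.
  (* Dependent unit vectors differ by a unimodular factor and have images of equal norm, against
     [1 < lam]. *)
  move=> [w [v v']] [/= [lv lv'] [v1 v'1]]; rewrite nm_gt0 subr_eq0; apply/eqP => D0.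
  have [|e vE] := @collinear R v' v v1.
    by rewrite [RHS]D0 mulrC.
  have e1 : nm e ^+ 2 = 1 by move: v'1; rewrite vE sqnormZ v1 mulr1.
  have := domP w _ _ lv' v'1 lv v1; rewrite vE transferZ.
  rewrite sqnormZ e1 mul1r -surjective_pairing.
  rewrite -[X in _ < X]mul1r ltNge; apply/negP; rewrite negbK.
  by rewrite ler_wpM2r ?sqrtr_ge0 ?ltW.
have [dl2 dl20 dl2P] : exists2 e : R, 0 < e & forall p, K p -> e <= sqnorm (Bu p).
  apply: compact_pos_lower_bound cK cBu _.
  (* An unstable vector killed in one step would be killed by the [N]-step product, as [N] is
     positive; the strict inequality of domination excludes this. *)
  move=> [w [v v']] [/= [lv lv'] [v1 v'1]]; rewrite lt_neqAle sqnorm_ge0 andbT eq_sym.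
  apply/eqP => B0.
  have {}B0 : transfer (offdiag w) (diag w) 1 v' = (0, 0).
    have : ~~ (0 < sqnorm (Bu (w, (v, v')))) by rewrite B0 ltxx.
    rewrite sqnorm_gt0 negb_or !negbK => /andP[/eqP h1 /eqP h2].
    by rewrite [LHS]surjective_pairing; congr pair.
  have := domP w _ _ lv' v'1 lv v1; rewrite -(prednK N0) (transfer_eq0 _ B0).
  rewrite [X in _ < Num.sqrt X](_ : _ = 0); last first.
    by rewrite /sqnorm Normc.normc0 expr0n addr0.
  rewrite sqrtr0 ltNge; apply/negP; rewrite negbK mulr_ge0 ?sqrtr_ge0//.
  exact: ltW.
(* [dl2] bounds a squared norm. *)
pose dl := Num.min dl1 (Num.sqrt dl2).
have iter_line (e : X -> R[i]) (v : X -> R[i] * R[i]) : (forall w,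
    transfer (offdiag w) (diag w) 1 (v w) = (e w * (v (T w)).1, e w * (v (T w)).2)) ->
  forall k w, transfer (offdiag w) (diag w) k (v w) =
    ((\prod_(i < k) e (iterz T i w)) * (v (iterz T k w)).1,
     (\prod_(i < k) e (iterz T i w)) * (v (iterz T k w)).2).
  move=> ve; elim=> [|k IH] w; first by rewrite big_ord0 !mul1r -surjective_pairing.
  rewrite [LHS]/= IH /=; have := ve (iterz T k w).
  rewrite transfer1 offdiag_iterz diag_iterz /shift !add0r.
  have -> : - 1 + k%:Z = k%:Z - 1 by lia.
  rewrite big_ord_recr /= => -[h1 h2].
  have -> : T (iter k T w) = T (iterz T k w) by [].
  congr pair; rewrite -mulrA -?h1 -?h2; ring.
exists s, u, c, d, N, (lam^-1), dl; split.
- by split; [rewrite invr_ge0 ltW|rewrite invf_lt1].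
- by rewrite lt_min dl10 sqrtr_gt0.
- by move=> w; have [] := sP w; have [] := uP w.
- by [].
move=> w; have [ls s1] := sP w; have [lu u1] := uP w.
have Kw : K (w, (s w, u w)) by [].
split.
- rewrite ge_min; apply/orP; right; have := dl2P _ Kw.
  rewrite /Bu /= -/(transfer _ _ 1 _) dP sqnormZ (uP (T w)).2 mulr1.
  by move=> /ler_wsqrtr; rewrite sqrtr_sqr ger0_norm ?normc_ge0.
- by rewrite ge_min; apply/orP; left; exact: dl1P _ Kw.
- have := domP w _ _ lu u1 ls s1.
  rewrite (iter_line _ _ cP) (iter_line _ _ dP) !sqnormZ (sP _).2 (uP _).2 !mulr1.
  rewrite !sqrtr_sqr !ger0_norm ?normc_ge0//.
  rewrite (@nm_prod _ N (fun i => c (iterz T i w))) (@nm_prod _ N (fun i => d (iterz T i w))).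
  by move=> h; rewrite -(ler_pM2l lam0) mulVKf ?gt_eqF// ltW.
Qed.

Lemma dominated_coercive_green w0 :
  (exists2 C : R, 0 <= C & coercive (offdiag w0) (diag w0) C) /\
  (forall m, exists g K, l2_le g K /\
    forall n, jac (offdiag w0) (diag w0) g n = (n == m)%:R).
Proof.
have [s [u [c [d [N [th [dl [[th0 th1] dl0 su1 inv bnd]]]]]]]] := dominated_data.
have [M [aM bM]] := coefficients_bounded cptX T a b E.
have dl_neq0 z : dl <= nm z -> z != 0 :> R[i].
  by move=> h; rewrite -nm_gt0; exact: lt_le_trans dl0 h.
have M0 : 0 <= M := le_trans (normc_ge0 _) (aM w0 0).
have TE w n : T (iterz T n w) = iterz T (n + 1) w.
  by rewrite addrC iterzD.
have S w n : - diag w n * (s (iterz T n w)).1 -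
    conjc (offdiag w (n - 1)) * (s (iterz T n w)).2 =
    c (iterz T n w) * (s (iterz T (n + 1) w)).1 /\
  offdiag w n * (s (iterz T n w)).1 = c (iterz T n w) * (s (iterz T (n + 1) w)).2.
  have [+ _] := inv (iterz T n w); rewrite transfer1 offdiag_iterz diag_iterz TE.
  by rewrite /shift !add0r [- 1 + n]addrC => -[].
have U w n : - diag w n * (u (iterz T n w)).1 -
    conjc (offdiag w (n - 1)) * (u (iterz T n w)).2 =
    d (iterz T n w) * (u (iterz T (n + 1) w)).1 /\
  offdiag w n * (u (iterz T n w)).1 = d (iterz T n w) * (u (iterz T (n + 1) w)).2.
  have [_ +] := inv (iterz T n w); rewrite transfer1 offdiag_iterz diag_iterz TE.
  by rewrite /shift !add0r [- 1 + n]addrC => -[].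
have dK w : nm (d w) <= 3 * M.
  have [_ Tu] := inv w; have u1 := (su1 w).2; have [h1 h2] := sqnorm1_le u1.
  have : sqnorm (transfer (offdiag w) (diag w) 1 (u w)) <= (3 * M) ^+ 2.
    rewrite transfer1 /sqnorm /=.
    have b1 (x y : R[i]) : nm x <= M -> nm y <= 1 -> nm (x * y) ^+ 2 <= M ^+ 2.
      move=> xM y1; apply: le_trans (nm_sqr_mul_le1 _ y1) _.
      by rewrite ler_sqr ?nnegrE ?normc_ge0.
    have := nm_sqrD (- diag w 0 * (u w).1) (- (conjc (offdiag w (- 1)) * (u w).2)).
    rewrite nmN; have := b1 (- diag w 0) (u w).1; rewrite nmN => /(_ (bM w 0) h1).
    have := b1 (conjc (offdiag w (- 1))) (u w).2; rewrite nm_conj => /(_ (aM w _) h2).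
    have := b1 (offdiag w 0) (u w).1 (aM w 0) h1.
    have := sqr_ge0 M; lra.
  rewrite Tu sqnormZ (su1 (T w)).2 mulr1 ler_sqr ?nnegrE ?normc_ge0//.
  by rewrite mulr_ge0.
have D2 w : nm ((s w).1 * (u w).2 - (s w).2 * (u w).1) <= 2.
  have [s1 u1] := su1 w; have [s11 s12] := sqnorm1_le s1; have [u11 u12] := sqnorm1_le u1.
  apply: le_trans (nmB _ _) _.
  have := nm_mulb s11 u12; have := nm_mulb s12 u11; lra.
have cd w n : \prod_(i < N) nm (c (iterz T (n + i%:Z) w)) <=
    th * \prod_(i < N) nm (d (iterz T (n + i%:Z) w)).
  have [_ _] := bnd (iterz T n w).
  by under eq_bigr do rewrite -iterzD addrC;
    under [in X in _ <= X -> _]eq_bigr do rewrite -iterzD addrC.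
split.
  apply: (splitting_coercive (fun n => (S w0 n).1) (fun n => (S w0 n).2)
    (fun n => (U w0 n).1) (fun n => (U w0 n).2) _ _ th0 th1 dl0 _ _
    (fun n => dK (iterz T n w0)) (fun n => D2 (iterz T n w0)) (aM w0) (cd w0)) => n;
    have [s1 u1] := su1 (iterz T n w0); have [dd dD _] := bnd (iterz T n w0);
    have [] := sqnorm1_le s1; have [] := sqnorm1_le u1 => //; by move=> *; exact: dl_neq0.
move=> m.
(* The column with pole [m] at [w0] is a translate of the one with pole 0 at the [m]-th iterate of
   [w0]. *)
have [g [K [gK jg]]] : exists g K, l2_le g K /\
    forall n, jac (shift m (offdiag w0)) (shift m (diag w0)) g n = (n == 0)%:R.
  rewrite -offdiag_iterz -diag_iterz; set w := iterz T m w0.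
  apply: (splitting_green0 (fun n => (S w n).1) (fun n => (S w n).2)
    (fun n => (U w n).1) (fun n => (U w n).2) _ _ th0 th1 dl0 _ _
    (fun n => dK (iterz T n w)) (fun n => D2 (iterz T n w)) (aM w) (cd w)) => n;
    have [s1 u1] := su1 (iterz T n w); have [dd dD _] := bnd (iterz T n w);
    have [] := sqnorm1_le s1; have [] := sqnorm1_le u1 => //; by move=> *; exact: dl_neq0.
exists (shift (- m) g), K; split; first exact: l2_shift.
move=> n; have := jac_shift (offdiag w0) (diag w0) (shift (- m) g) m (n - m).
have -> : shift m (shift (- m) g) = g by apply/funext => k; rewrite /shift addrK.
by rewrite subrK jg subr_eq0 => <-.
Qed.

(** The inequality gives injectivity and the bound on the inverse, [jac_surjective] gives
    surjectivity. The inverse is chosen value by value; it is linear because [J] is linear and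
    injective. *)
Lemma dominated_resolvent w0 : resolvent_set (jacobi T a b cptX w0) E.
Proof.
have [[C C0 co] green] := dominated_coercive_green w0.
pose J := jacobi_sub cptX T a b E w0.
suff: bounded_inverse J by move=> h; apply.
have JE f n : J f n = jac (offdiag w0) (diag w0) f n by exact: jacobi_subE.
have Jlin (r : R[i]) f g : J (r *: f + g) = r *: J f + J g.
  apply/val_inj/funext => n; rewrite [LHS]JE.
  have -> : val (r *: J f + J g) n = r * J f n + J g n by [].
  by rewrite !JE -jacZ -jacD.
have ell2_norm_l2 (f : ell2 R) : l2_le f (ell2_norm f ^+ 2).
  by apply/ell2_normP => //; exact: ell2_norm_ge0.
have bound f : ell2_norm f <= Num.sqrt C * ell2_norm (J f).
  apply/ell2_normP; first by rewrite mulr_ge0 ?sqrtr_ge0 ?ell2_norm_ge0.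
  rewrite exprMn sqr_sqrtr//; apply: co (ell2_norm_l2 f) _.
  by apply: le_sums_le (ell2_norm_l2 (J f)) => n; rewrite JE.
have Jinj f g : J f = J g -> f = g.
  move=> fg; apply/eqP; rewrite -subr_eq0; apply/eqP/ell2_norm_eq0.
  have J0 : J (f - g) = 0 by rewrite -scaleN1r addrC Jlin scaleN1r fg addNr.
  have := bound (f - g); rewrite J0.
  have -> : ell2_norm (0 : ell2 R) = 0.
    by apply/eqP; rewrite eq_le ell2_norm_ge0 andbT; apply/ell2_normP => // t _;
      rewrite big1 ?expr0n// => i _; rewrite Normc.normc0 expr0n.
  by rewrite mulr0 => h; apply/eqP; rewrite eq_le h ell2_norm_ge0.
have /choice[S SJ] : forall f, exists g, J g = f.
  move=> f; have [g gK jg] := jac_surjective co green (ell2_norm_l2 f).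
  exists (Ell2 (l2_le_ell2 gK)); apply/val_inj/funext => n.
  by rewrite [LHS]JE.
have Slin : GRing.linear_for *:%R S.
  by move=> r f g; apply: Jinj; rewrite Jlin !SJ.
pose SL : {linear ell2 R -> ell2 R} := HB.pack S (GRing.isLinear.Build _ _ _ _ S Slin).
exists SL; split.
- apply/linear_bounded_continuous/linear_boundedP.
  exists ((Num.sqrt C)%:C)%C; split; first by rewrite realE lecR sqrtr_ge0.
  move=> r Cr f; apply: le_trans (_ : ((Num.sqrt C)%:C)%C * `|f| <= _).
    by rewrite /Num.norm /= /ell2_normC -rmorphM lecR -{2}(SJ f) bound.
  by apply: ler_wpM2r; [exact: normr_ge0|exact: ltW].
- by move=> f; apply: Jinj; rewrite /= SJ.
- by move=> f; rewrite /= SJ.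
Qed.

End dominated_resolvent.

Theorem theorem7 (R : realType) (Omega : metricType R)
  (cptOmega : compact [set: Omega]) (T : homeo Omega)
  (a : continuousType Omega R[i]) (b : continuousType Omega R)
  (transT : topologically_transitive T)
  (w0 : Omega) (dense_w0 : closure (two_sided_orbit T w0) = [set: Omega]) :
  resolvent_set (jacobi T a b cptOmega w0)
  = [set E : R[i] | dominated_splitting T (jacobi_cocycle T a b E)].
Proof.
apply/seteqP; split=> E; first by move=> /resolvent_dominated; exact.
by move=> ds; exact: (@dominated_resolvent R Omega cptOmega T a b E ds w0).
Qed.
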